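(* Let $\mathbb{K}$ be an algebraically closed field of characteristic $p>2$, let $r\ge1$ with $p\nmid r$, $n\ge 1$, $I=\mathbb{Z}\cdot1\subset\mathbb{K}$ and $J=\{1,\dots,r\}$. Let $\bm{\lambda}\in \mathrm{Cont}_{p}(D_{r,n})/\sim$ be an equivalence class. Then there exists an irreducible completely splittable $D_{r,n}$-module $D^{\bm{\lambda}}$ whose weights are exactly the elements of $\bm{\lambda}$. The module $D^{\bm{\lambda}}$ has a basis $\{v_{(\alpha,j)} : (\alpha,j)\in \bm{\lambda}\}$ with $D_{r,n}$-action given by $$t_{i}v_{(\alpha,j)}=\zeta_{j_{i}}v_{(\alpha,j)},\qquad x_{i}v_{(\alpha,j)}=\alpha_{i}v_{(\alpha,j)}\qquad (1\leq i\leq n),$$ and, for $1\le k\le n-1$: if $j_{k}\neq j_{k+1}$, then $f_{k}v_{(\alpha,j)}=v_{(s_{k}\alpha,s_{k}j)}$; if $j_{k}=j_{k+1}$, then $$f_{k}v_{(\alpha,j)}=(\alpha_{k+1}-\alpha_{k})^{-1}v_{(\alpha,j)}+\sqrt{1-(\alpha_{k+1}-\alpha_{k})^{-2}}\;v_{(s_{k}\alpha,j)},$$ where a fixed choice of square roots in $\mathbb{K}$ is used, and the second term is read as $0$ when $\alpha_{k+1}=\alpha_k\pm1$ (its coefficient being $0$). Moreover, every irreducible completely splittable representation of $D_{r,n}$ is obtained in this way (up to isomorphism).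
   Context: The degenerate affine Yokonuma-Hecke algebra $D_{r,n}$ is the associative unital $\mathbb{K}$-algebra generated by $t_1,\dots,t_n,f_1,\dots,f_{n-1},x_1,\dots,x_n$ with relations: $f_if_j=f_jf_i$ for $|i-j|\ge2$; $f_if_{i+1}f_i=f_{i+1}f_if_{i+1}$; $t_it_j=t_jt_i$; $f_it_j=t_{s_i(j)}f_i$ with $s_i=(i,i+1)$; $t_i^r=1$; $f_i^2=1$; $x_ix_j=x_jx_i$; $f_ix_{i+1}=x_if_i+e_i$ where $e_i=\frac1r\sum_{s=0}^{r-1}t_i^st_{i+1}^{-s}$; $f_ix_j=x_jf_i$ for $j\ne i,i+1$; $t_jx_i=x_it_j$ for all $i,j$. Fix a primitive $r$-th root of unity $\zeta\in\mathbb{K}$ and put $\zeta_k=\zeta^{k-1}$, $1\le k\le r$. All modules considered are in $\mathrm{Rep}_I D_{r,n}$: finite-dimensional modules on which all eigenvalues of the $x_i$ lie in $I$. For $(\alpha,j)=((\alpha_1,\dots,\alpha_n),(j_1,\dots,j_n))\in I^n\times J^n$ the weight space is $M_{(\alpha,j)}=\{m\in M: (x_i-\alpha_i)^Nm=(t_i-\zeta_{j_i})m=0\ \text{for all } i \text{ and } N\gg0\}$; $(\alpha,j)$ is a weight of $M$ if $M_{(\alpha,j)}\ne0$. $M$ is completely splittable if $x_1,\dots,x_n$ act semisimply (diagonalizably) on $M$. $\mathrm{Cont}_p(D_{r,n})$ (content vectors of length $n$) is the set of $(\alpha,j)\in I^n\times J^n$ such that whenever $\alpha_i=\alpha_k$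 and $j_i=j_k$ for some $1\le i<k\le n$, one has $\{\alpha_i+1,\alpha_i-1\}\subseteq\{\alpha_l : i<l<k,\ j_l=j_i\}$. The transposition $s_i$ is admissible with respect to $(\alpha,j)$ if either $j_i\neq j_{i+1}$, or $j_i=j_{i+1}$ and $\alpha_{i+1}\neq\alpha_i\pm1$; it sends $(\alpha,j)$ to $(s_i\alpha,s_ij)$, obtained by exchanging the $i$-th and $(i+1)$-st entries of both $\alpha$ and $j$. Two elements are equivalent ($\sim$) if one can be obtained from the other by a sequence of admissible transpositions. *)

(* Defs.v *)
From HB Require Import structures.
From mathcomp Require Import all_boot all_order all_algebra.
From mathcomp Require Import perm generic_quotient boolp classical_sets.

Set Implicit Arguments.
Unset Strict Implicit.
Unset Printing Implicit Defensive.

Import GRing.Theory.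

Local Open Scope ring_scope.

(* The 1-based index set {1, ..., n} is 'I_n = {0, ..., n-1}.  An index        *)
(* 1 <= k <= n-1 of a generator f_k is k : 'I_n.-1, and the positions k and     *)
(* k+1 of {1, ..., n} are [lo k] and [hi k].                                    *)
Definition lo n (k : 'I_n.-1) : 'I_n := widen_ord (leq_pred n) k.

Lemma hi_subproof n (k : 'I_n.-1) : (k.+1 < n)%N.
Proof. by rewrite -ltn_predRL. Qed.

Definition hi n (k : 'I_n.-1) : 'I_n := Ordinal (hi_subproof k).

Definition sperm n (k : 'I_n.-1) : {perm 'I_n} := tperm (lo k) (hi k).

(* D_{r,n} is presented as the quotient of the formal noncommutative           *)
(* polynomial expressions by the smallest congruence containing the axioms of   *)
(* associative unital K-algebras and the defining relations.                    *)
Section Presentation.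
Variables (K : fieldType) (r n : nat).

Inductive dterm : Type :=
  | DScal of K
  | DT of 'I_n
  | DF of 'I_n.-1
  | DX of 'I_n
  | DAdd of dterm & dterm
  | DMul of dterm & dterm.

Definition dexp (u : dterm) (m : nat) : dterm := iter m (DMul u) (DScal 1).

(* t^{-s} is written t^{r-s}, as t^r = 1. *)
Definition de (k : 'I_n.-1) : dterm :=
  DMul (DScal r%:R^-1)
    (\big[DAdd/DScal 0]_(s < r) DMul (dexp (DT (lo k)) s)
                                     (dexp (DT (hi k)) (r - s))).

Inductive drel : dterm -> dterm -> Prop :=
  | drel_ff (k l : 'I_n.-1) : (k.+1 < l)%N || (l.+1 < k)%N ->
      drel (DMul (DF k) (DF l)) (DMul (DF l) (DF k))
  | drel_braid (k l : 'I_n.-1) : l = k.+1 :> nat ->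
      drel (DMul (DF k) (DMul (DF l) (DF k)))
           (DMul (DF l) (DMul (DF k) (DF l)))
  | drel_tt (i j : 'I_n) : drel (DMul (DT i) (DT j)) (DMul (DT j) (DT i))
  | drel_ft (k : 'I_n.-1) (j : 'I_n) :
      drel (DMul (DF k) (DT j)) (DMul (DT (sperm k j)) (DF k))
  | drel_tr (i : 'I_n) : drel (dexp (DT i) r) (DScal 1)
  | drel_f2 (k : 'I_n.-1) : drel (DMul (DF k) (DF k)) (DScal 1)
  | drel_xx (i j : 'I_n) : drel (DMul (DX i) (DX j)) (DMul (DX j) (DX i))
  | drel_fx (k : 'I_n.-1) :
      drel (DMul (DF k) (DX (hi k))) (DAdd (DMul (DX (lo k)) (DF k)) (de k))
  | drel_fx_far (k : 'I_n.-1) (j : 'I_n) : j != lo k -> j != hi k ->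
      drel (DMul (DF k) (DX j)) (DMul (DX j) (DF k))
  | drel_tx (i j : 'I_n) : drel (DMul (DT j) (DX i)) (DMul (DX i) (DT j)).

Inductive dcong : dterm -> dterm -> Prop :=
  | dcong_rel u v : drel u v -> dcong u v
  | dcong_refl u : dcong u u
  | dcong_sym u v : dcong u v -> dcong v u
  | dcong_trans v u w : dcong u v -> dcong v w -> dcong u w
  | dcong_add u u' v v' :
      dcong u u' -> dcong v v' -> dcong (DAdd u v) (DAdd u' v')
  | dcong_mul u u' v v' :
      dcong u u' -> dcong v v' -> dcong (DMul u v) (DMul u' v')
  | dcong_addA u v w : dcong (DAdd u (DAdd v w)) (DAdd (DAdd u v) w)
  | dcong_addC u v : dcong (DAdd u v) (DAdd v u)
  | dcong_add0 u : dcong (DAdd (DScal 0) u) u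
  | dcong_addN u : dcong (DAdd (DMul (DScal (-1)) u) u) (DScal 0)
  | dcong_mulA u v w : dcong (DMul u (DMul v w)) (DMul (DMul u v) w)
  | dcong_mul1 u : dcong (DMul (DScal 1) u) u
  | dcong_mulDl u v w : dcong (DMul (DAdd u v) w) (DAdd (DMul u w) (DMul v w))
  | dcong_mulDr u v w : dcong (DMul u (DAdd v w)) (DAdd (DMul u v) (DMul u w))
  | dcong_scalD a b : dcong (DScal (a + b)) (DAdd (DScal a) (DScal b))
  | dcong_scalM a b : dcong (DScal (a * b)) (DMul (DScal a) (DScal b))
  | dcong_scalC a u : dcong (DMul (DScal a) u) (DMul u (DScal a)).

HB.instance Definition _ := gen_eqMixin dterm.
HB.instance Definition _ := gen_choiceMixin dterm.

Definition dcongb : rel dterm := fun u v => `[< dcong u v >].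

Fact dcongb_refl : reflexive dcongb.
Proof. by move=> u; apply/asboolP; apply: dcong_refl. Qed.
Fact dcongb_sym : symmetric dcongb.
Proof. by move=> u v; apply/asboolP/asboolP; apply: dcong_sym. Qed.
Fact dcongb_trans : transitive dcongb.
Proof.
by move=> v u w /asboolP uv /asboolP vw; apply/asboolP; apply: dcong_trans vw.
Qed.

Canonical dcong_equiv := EquivRel dcongb dcongb_refl dcongb_sym dcongb_trans.

Definition Drn : Type := {eq_quot dcong_equiv}%qT.

HB.instance Definition _ := Choice.on Drn.

Definition dclass (u : dterm) : Drn := (\pi_{eq_quot dcong_equiv} u)%qT.
Definition drepr (a : Drn) : dterm := repr a.

Lemma dreprK : cancel drepr dclass.
Proof. by move=> a; apply: reprK. Qed.

Lemma dclass_eq u v : dclass u = dclass v <-> dcong u v.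
Proof.
split=> [/eqP|uv]; first by rewrite /dclass eqmodE => /asboolP.
by apply/eqP; rewrite /dclass eqmodE; apply/asboolP.
Qed.

Lemma dreprP u : dcong (drepr (dclass u)) u.
Proof. by apply/dclass_eq; rewrite dreprK. Qed.

Definition Dscal (c : K) : Drn := dclass (DScal c).
Definition Dadd (a b : Drn) : Drn := dclass (DAdd (drepr a) (drepr b)).
Definition Dmul (a b : Drn) : Drn := dclass (DMul (drepr a) (drepr b)).

Lemma DaddE u v : Dadd (dclass u) (dclass v) = dclass (DAdd u v).
Proof. by apply/dclass_eq/dcong_add; apply: dreprP. Qed.

Lemma DmulE u v : Dmul (dclass u) (dclass v) = dclass (DMul u v).
Proof. by apply/dclass_eq/dcong_mul; apply: dreprP. Qed.

Definition Dopp (a : Drn) : Drn := Dmul (Dscal (-1)) a.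
Definition Dscale (c : K) (a : Drn) : Drn := Dmul (Dscal c) a.

Fact DaddA : associative Dadd.
Proof.
move=> a b c; rewrite -[a]dreprK -[b]dreprK -[c]dreprK !DaddE.
exact/dclass_eq/dcong_addA.
Qed.
Fact DaddC : commutative Dadd.
Proof.
move=> a b; rewrite -[a]dreprK -[b]dreprK !DaddE.
exact/dclass_eq/dcong_addC.
Qed.
Fact Dadd0 : left_id (Dscal 0) Dadd.
Proof. by move=> a; rewrite -[a]dreprK DaddE; exact/dclass_eq/dcong_add0. Qed.
Fact DaddN : left_inverse (Dscal 0) Dopp Dadd.
Proof.
by move=> a; rewrite -[a]dreprK /Dopp DmulE DaddE; exact/dclass_eq/dcong_addN.
Qed.
Fact DmulA : associative Dmul.
Proof.
move=> a b c; rewrite -[a]dreprK -[b]dreprK -[c]dreprK !DmulE.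
exact/dclass_eq/dcong_mulA.
Qed.
Fact Dmul1l : left_id (Dscal 1) Dmul.
Proof. by move=> a; rewrite -[a]dreprK DmulE; exact/dclass_eq/dcong_mul1. Qed.
Fact DscalC c a : Dmul (Dscal c) a = Dmul a (Dscal c).
Proof. by rewrite -[a]dreprK !DmulE; exact/dclass_eq/dcong_scalC. Qed.
Fact Dmul1r : right_id (Dscal 1) Dmul.
Proof. by move=> a; rewrite -DscalC Dmul1l. Qed.
Fact DmulDl : left_distributive Dmul Dadd.
Proof.
move=> a b c; rewrite -[a]dreprK -[b]dreprK -[c]dreprK !(DmulE, DaddE).
exact/dclass_eq/dcong_mulDl.
Qed.
Fact DmulDr : right_distributive Dmul Dadd.
Proof.
move=> a b c; rewrite -[a]dreprK -[b]dreprK -[c]dreprK !(DmulE, DaddE).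
exact/dclass_eq/dcong_mulDr.
Qed.
Fact DscalD a b : Dscal (a + b) = Dadd (Dscal a) (Dscal b).
Proof. by rewrite DaddE; exact/dclass_eq/dcong_scalD. Qed.
Fact DscalM a b : Dscal (a * b) = Dmul (Dscal a) (Dscal b).
Proof. by rewrite DmulE; exact/dclass_eq/dcong_scalM. Qed.

(* The one-dimensional representation t_i = f_k = 1, x_i = i e shows 1 <> 0. *)
Let e0 : K := r%:R^-1 * r%:R.
Fixpoint dtriv (u : dterm) : K :=
  match u with
  | DScal c => c
  | DT _ | DF _ => 1
  | DX i => i%:R * e0
  | DAdd u v => dtriv u + dtriv v
  | DMul u v => dtriv u * dtriv v
  end.

Fact dtriv_expT i m : dtriv (dexp (DT i) m) = 1.
Proof. by elim: m => //= m ->; rewrite mulr1. Qed.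

Fact dtriv_de k : dtriv (de k) = e0.
Proof.
rewrite /= (big_morph dtriv (id1 := 0) (op1 := +%R)) //.
under eq_bigr do rewrite /= !dtriv_expT mulr1.
by rewrite sumr_const card_ord.
Qed.

Fact dtriv_cong u v : dcong u v -> dtriv u = dtriv v.
Proof.
elim=> {u v} //=; last 1 first.
- by move=> a u; rewrite mulrC.
- move=> u v [].
  + by move=> k l _ /=.
  + by move=> k l _ /=.
  + by move=> i j /=.
  + by move=> k j /=.
  + by move=> i; rewrite dtriv_expT.
  + by move=> k /=; rewrite mulr1.
  + by move=> i j /=; rewrite mulrC.
  + move=> k.
    change (1 * ((hi k)%:R * e0) = (lo k)%:R * e0 * 1 + dtriv (de k)).
    by rewrite dtriv_de mul1r mulr1 /= -addn1 natrD mulrDl mul1r.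
  + by move=> k j _ _ /=; rewrite mulrC.
  + by move=> i j /=; rewrite mulrC.
- by move=> v u w _ -> _ ->.
- by move=> u u' v v' _ -> _ ->.
- by move=> u u' v v' _ -> _ ->.
- by move=> u v w; rewrite addrA.
- by move=> u v; rewrite addrC.
- by move=> u; rewrite add0r.
- by move=> u; rewrite mulN1r addNr.
- by move=> u v w; rewrite mulrA.
- by move=> u; rewrite mul1r.
- by move=> u v w; rewrite mulrDl.
- by move=> u v w; rewrite mulrDr.
Qed.

Fact Done_neq0 : Dscal 1 != Dscal 0.
Proof.
by apply/eqP => /dclass_eq/dtriv_cong /= /eqP; rewrite oner_eq0.
Qed.

HB.instance Definition _ :=
  GRing.isZmodule.Build Drn DaddA DaddC Dadd0 DaddN.
HB.instance Definition _ := GRing.Zmodule_isNzRing.Build Drn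
  DmulA Dmul1l Dmul1r DmulDl DmulDr Done_neq0.

Fact DscaleA a b (v : Drn) : Dscale a (Dscale b v) = Dscale (a * b) v.
Proof. by rewrite /Dscale DscalM DmulA. Qed.
Fact DscaleDr : right_distributive Dscale +%R.
Proof. by move=> c a b; apply: DmulDr. Qed.
Fact DscaleDl (v : Drn) : {morph Dscale^~ v : a b / a + b}.
Proof. by move=> a b; rewrite /Dscale DscalD; apply: DmulDl. Qed.

HB.instance Definition _ := GRing.Zmodule_isLmodule.Build K Drn
  DscaleA Dmul1l DscaleDr DscaleDl.

Fact DscaleAl (c : K) (a b : Drn) : c *: (a * b) = (c *: a) * b.
Proof. exact: DmulA. Qed.
HB.instance Definition _ := GRing.Lmodule_isLalgebra.Build K Drn DscaleAl.

Fact DscaleAr (c : K) (a b : Drn) : c *: (a * b) = a * (c *: b).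
Proof.
change (Dmul (Dscal c) (Dmul a b) = Dmul a (Dmul (Dscal c) b)).
by rewrite !DmulA [Dmul (Dscal c) a]DscalC.
Qed.
HB.instance Definition _ := GRing.Lalgebra_isAlgebra.Build K Drn DscaleAr.

Definition tgen (i : 'I_n) : Drn := dclass (DT i).
Definition fgen (k : 'I_n.-1) : Drn := dclass (DF k).
Definition xgen (i : 'I_n) : Drn := dclass (DX i).

Lemma dclass_rel u v : drel u v -> dclass u = dclass v.
Proof. by move=> uv; apply/dclass_eq/dcong_rel. Qed.

Lemma dclassD u v : dclass (DAdd u v) = dclass u + dclass v.
Proof. by rewrite -DaddE. Qed.

Lemma dclassM u v : dclass (DMul u v) = dclass u * dclass v.
Proof. by rewrite -DmulE. Qed.

Lemma dclassS c : dclass (DScal c) = c%:A.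
Proof. by symmetry; apply: Dmul1r. Qed.

End Presentation.

Arguments Drn : clear implicits.
Arguments tgen K r {n} i.
Arguments fgen K r {n} k.
Arguments xgen K r {n} i.

(* Finite-dimensional left D_{r,n}-modules. *)
Record Dmodule (K : fieldType) (r n : nat) := DModule {
  dcarrier :> vectType K;
  dact : Drn K r n -> 'End(dcarrier);
  dact_linear : linear dact;
  dact1 : forall v : dcarrier, dact 1 v = v;
  dactM : forall (a b : Drn K r n) (v : dcarrier),
    dact (a * b) v = dact a (dact b v)
}.

Arguments dact {K r n} M a : rename.

Section Modules.
Variables (K : fieldType) (r n : nat).
Implicit Types M N : Dmodule K r n.

Definition Dirreducible M : Prop :=
  fullv != 0%VS :> {vspace M} /\
  forall U : {vspace M}, (forall a, (dact M a @: U <= U)%VS) ->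
    U = 0%VS \/ U = fullv.

Definition Diso M N : Prop :=
  exists2 phi : 'Hom(M, N), bijective phi &
    forall (a : Drn K r n) (v : M), phi (dact M a v) = dact N a (phi v).

Definition inI (a : K) : Prop := exists z : int, a = z%:~R.

Definition RepI M : Prop :=
  forall (i : 'I_n) (a : K), passmx.leigenvalue (dact M (xgen K r i)) a -> inI a.

Definition lfun_diagonalizable (V : vectType K) (f : 'End(V)) : Prop :=
  exists2 b : seq V, basis_of fullv b &
    forall v, v \in b -> exists a : K, f v = a *: v.

Definition completely_splittable M : Prop :=
  forall i : 'I_n, lfun_diagonalizable (dact M (xgen K r i)).

(* A pair (alpha, j); the element k of J = {1, ..., r} is encoded by k-1, so   *)
(* that zeta_k = zeta^(k-1) reads zeta ^+ j.  Membership of the alpha_i in I is *)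
(* the separate condition [weightI].                                            *)
Definition Dweight : Type := ({ffun 'I_n -> K} * {ffun 'I_n -> 'I_r})%type.
HB.instance Definition _ := Choice.on Dweight.

Definition weightI (w : Dweight) : Prop := forall i, inI (w.1 i).

Definition in_weight_space (zeta : K) M (w : Dweight) (m : M) : Prop :=
  forall i : 'I_n,
    (exists N0 : nat, forall N : nat, (N0 <= N)%N ->
       iter N (dact M (xgen K r i) - w.1 i *: \1)%VF m = 0) /\
    (dact M (tgen K r i) - zeta ^+ w.2 i *: \1)%VF m = 0.

Definition is_weight (zeta : K) M (w : Dweight) : Prop :=
  weightI w /\ exists2 m : M, m != 0 & in_weight_space zeta w m.

Definition Cont (w : Dweight) : Prop :=
  weightI w /\
  forall i k : 'I_n, (i < k)%N -> w.1 i = w.1 k -> w.2 i = w.2 k ->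
    forall a : K, a = w.1 i + 1 \/ a = w.1 i - 1 ->
      exists l : 'I_n, [/\ (i < l)%N, (l < k)%N, w.2 l = w.2 i & w.1 l = a].

Definition swap (T : Type) (k : 'I_n.-1) (g : {ffun 'I_n -> T}) :
  {ffun 'I_n -> T} := [ffun i => g (sperm k i)].

Definition swapw (k : 'I_n.-1) (w : Dweight) : Dweight :=
  (swap k w.1, swap k w.2).

Definition admissible (k : 'I_n.-1) (w : Dweight) : bool :=
  (w.2 (lo k) != w.2 (hi k)) ||
  [&& w.2 (lo k) == w.2 (hi k), w.1 (hi k) != w.1 (lo k) + 1
    & w.1 (hi k) != w.1 (lo k) - 1].

Definition adm_step : rel Dweight :=
  fun w w' => [exists k : 'I_n.-1, admissible k w && (w' == swapw k w)].

Definition wequiv (w w' : Dweight) : Prop :=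
  exists2 s : seq Dweight, path adm_step w s & w' = last w s.

Definition Cont_class (lam : set Dweight) : Prop :=
  exists2 w, Cont w & lam = [set w' | Cont w' /\ wequiv w w']%classic.

(* [v] is only meaningful on lam; its values elsewhere are irrelevant, since    *)
(* v_(s_k alpha, j) with (s_k alpha, j) outside lam has coefficient sq 0 = 0.   *)
Definition is_lam_basis M (lam : set Dweight) (v : Dweight -> M) : Prop :=
  exists s : seq Dweight,
    [/\ uniq s, forall w, w \in s <-> lam w & basis_of fullv [seq v w | w <- s]].

Definition seminormal_action (zeta : K) (sq : K -> K) M (lam : set Dweight)
  (v : Dweight -> M) : Prop :=
  forall w, lam w ->
    (forall i : 'I_n,
       dact M (tgen K r i) (v w) = zeta ^+ w.2 i *: v w /\
       dact M (xgen K r i) (v w) = w.1 i *: v w) /\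
    (forall k : 'I_n.-1,
       let d := (w.1 (hi k) - w.1 (lo k))^-1 in
       (w.2 (lo k) <> w.2 (hi k) ->
          dact M (fgen K r k) (v w) = v (swap k w.1, swap k w.2)) /\
       (w.2 (lo k) = w.2 (hi k) ->
          dact M (fgen K r k) (v w) =
            d *: v w + sq (1 - d ^+ 2) *: v (swap k w.1, w.2))).

End Modules.

(* Main.v *)
From HB Require Import structures.
Require Import Defs.
From mathcomp Require Import all_boot all_order all_algebra.
From mathcomp Require Import fingroup perm.
From mathcomp Require Import boolp classical_sets.
From mathcomp Require Import zify ring.
Import GRing.Theory.
Local Open Scope ring_scope.

Set Implicit Arguments.
Unset Strict Implicit.
Unset Printing Implicit Defensive.

(* On a vector of weight w, subtracting from f_k its expected diagonal          *)
(* coefficient a = (w_{k+1} - w_k)^-1 (or 0 when the colours differ) gives a    *)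
(* map into weight s_k w.  Suitably rescaled, these intertwiners satisfy the    *)
(* braid relations, by the Yang-Baxter identity a b = c (a + b) for the inverse *)
(* differences a, b, c of three distinct numbers, and they square to 1 or 0     *)
(* according as s_k is admissible or not.  Read forwards, this shows that the   *)
(* seminormal formulas define a module: three consecutive entries of a content  *)
(* vector are distinct, and the span of a class is stable because inadmissible  *)
(* transpositions have coefficient 0.                                           *)
(*   Conversely, a weight vector v of weight w of an irreducible completely     *)
(* splittable M yields, by composing intertwiners along descents, a family u_s  *)
(* indexed by S_n that spans M.  Semisimplicity of the x_i forbids two adjacent *)
(* equal entries, so u_s <> 0 only if s never exchanges equal entries of w,     *)
(* and then s is determined by the weight of u_s.  Hence an inadmissible        *)
(* transposition must kill v, for otherwise its image would generate a          *)
(* submodule missing v, and M has the seminormal form on the class of w.        *)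

(** * Descents in the symmetric group *)

(** Both directions use the same computation, [braid_defect] with [diagc_yang_baxter]: on a weight
    vector, the two sides of the braid relation differ only by a multiple of the difference of the
    two extreme vectors. For the module being built ([F_braid]) these vectors coincide, which proves
    the relation; for a given module ([phi_braid]) the relation holds, which proves that they
    coincide. For a given irreducible M, [diamond] then produces the family of [phi_family],
    [ordpres_inj] recovers the index of a nonzero member from its weight, and [phi_inadmissible]
    gives the seminormal formula [f_seminormal]. Weights of M are content vectors by
    [weight_of_between], and [Diso_of_weight] matches the family with the basis of the module from
    [seminormal_module_exists]. That module is irreducible since [separating_element] isolates
    single basis vectors and admissible steps connect them. *)

Section Indices.
Variable n : nat.
Implicit Types (i j : 'I_n) (k l : 'I_n.-1).

Definition far k l := (k.+1 < l)%N || (l.+1 < k)%N.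

Lemma far_sym k l : far k l = far l k.
Proof. by rewrite /far orbC. Qed.

Lemma lo_neq_hi k : (lo k == hi k) = false.
Proof. by apply/negbTE; rewrite -val_eqE /=; lia. Qed.

Lemma hi_neq_lo k : (hi k == lo k) = false.
Proof. by rewrite eq_sym lo_neq_hi. Qed.

Lemma lo_next k l : l = k.+1 :> nat -> lo l = hi k.
Proof. by move=> e; apply: val_inj. Qed.

Lemma lo_neq_hi_next k l : l = k.+1 :> nat -> (lo k == hi l) = false.
Proof. by move=> e; apply/negbTE; rewrite -val_eqE /=; lia. Qed.

Lemma hi_neq_hi_next k l : l = k.+1 :> nat -> (hi k == hi l) = false.
Proof. by move=> e; apply/negbTE; rewrite -val_eqE /=; lia. Qed.

Lemma far_neq k l : far k l ->
  [/\ lo k != lo l, lo k != hi l, hi k != lo l & hi k != hi l].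
Proof. by rewrite /far -!val_eqE /= => h; split; lia. Qed.

Lemma index_cases k l :
  [\/ k = l, l = k.+1 :> nat, k = l.+1 :> nat | far k l].
Proof.
have [|||] : [\/ (k = l :> nat), l = k.+1 :> nat, k = l.+1 :> nat | far k l].
- rewrite /far; case: (ltngtP k l) => h.
  + have [->|h'] := eqVneq (l : nat) k.+1; first by constructor 2.
    by constructor 4; lia.
  + have [->|h'] := eqVneq (k : nat) l.+1; first by constructor 3.
    by constructor 4; lia.
  + by constructor 1.
- by move=> h; constructor 1; apply: val_inj.
- by constructor 2.
- by constructor 3.
- by constructor 4.
Qed.

Lemma spermL k : sperm k (lo k) = hi k. Proof. exact: tpermL. Qed.
Lemma spermR k : sperm k (hi k) = lo k. Proof. exact: tpermR. Qed.
Lemma spermD k i : i != lo k -> i != hi k -> sperm k i = i.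
Proof. by move=> h1 h2; rewrite /sperm tpermD // eq_sym. Qed.
Lemma spermK k : involutive (sperm k). Proof. exact: tpermK. Qed.

Lemma sperm_mulK k (s : 'S_n) : (sperm k * (sperm k * s))%g = s.
Proof. by apply/permP => i; rewrite !permM spermK. Qed.

Lemma sperm_far k l i : far k l -> sperm k (sperm l i) = sperm l (sperm k i).
Proof.
move=> /far_neq[h1 h2 h3 h4].
have [->|ik] := eqVneq i (lo k); first by rewrite spermL !(@spermD l) // spermL.
have [->|ik'] := eqVneq i (hi k); first by rewrite spermR !(@spermD l) // spermR.
rewrite (spermD ik) //; have [->|il] := eqVneq i (lo l).
  by rewrite !spermL spermD // eq_sym.
have [->|il'] := eqVneq i (hi l); first by rewrite !spermR spermD // eq_sym.
by rewrite !spermD.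
Qed.

Lemma sperm_braid k l i : l = k.+1 :> nat ->
  sperm k (sperm l (sperm k i)) = sperm l (sperm k (sperm l i)).
Proof.
move=> e; have el := lo_next e.
have h1 := lo_neq_hi_next e; have h2 := hi_neq_hi_next e.
have h1' := h1; rewrite eq_sym in h1'; have h2' := h2; rewrite eq_sym in h2'.
have lk : sperm l (lo k) = lo k by rewrite spermD ?el ?lo_neq_hi ?h1.
have kl : sperm k (hi l) = hi l by rewrite spermD ?h1' ?h2'.
have lh : sperm l (hi k) = hi l by rewrite -el spermL.
have hl : sperm l (hi l) = hi k by rewrite -el spermR.
have [->|i1] := eqVneq i (lo k); first by rewrite spermL lh kl lk spermL lh.
have [->|i2] := eqVneq i (hi k); first by rewrite spermR lk spermL lh kl hl.
have [->|i3] := eqVneq i (hi l); first by rewrite kl hl spermR lk.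
have fk : sperm k i = i by rewrite spermD.
have fl : sperm l i = i by rewrite spermD ?el.
by rewrite !(fk, fl).
Qed.

Lemma sperm_mul_far k l (s : 'S_n) : far k l ->
  (sperm k * (sperm l * s))%g = (sperm l * (sperm k * s))%g.
Proof. by move=> kl; apply/permP => i; rewrite !permM -(sperm_far i kl). Qed.

Lemma sperm_mul_braid k l (s : 'S_n) : l = k.+1 :> nat ->
  (sperm k * (sperm l * (sperm k * s)))%g =
  (sperm l * (sperm k * (sperm l * s)))%g.
Proof. by move=> kl; apply/permP => i; rewrite !permM (sperm_braid i kl). Qed.

(** Products of permutations act from left to right, so [sperm k * s] is [s] with its values at the
    positions k and k+1 exchanged. *)
Definition descent k (s : 'S_n) := (s (hi k) < s (lo k))%N.

Lemma descent_swap k (s : 'S_n) : descent k (sperm k * s)%g = ~~ descent k s.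
Proof.
rewrite /descent !permM spermL spermR -leqNgt ltn_neqAle val_eqE.
by rewrite (inj_eq perm_inj) lo_neq_hi.
Qed.

(* A stand-in for the Coxeter length: only its decrease along descents matters. *)
Definition disorder (s : 'S_n) := (\sum_(i < n) (n - i) * s i)%N.

(** The weights of the positions k and k+1 differ by one, so the exchange lowers the sum by exactly
    [s (lo k) - s (hi k)]. *)
Lemma disorder_descent k (s : 'S_n) :
  descent k s -> (disorder (sperm k * s) < disorder s)%N.
Proof.
rewrite /descent /disorder => h.
rewrite (bigD1 (lo k)) // (bigD1 (hi k)) ?hi_neq_lo //=.
rewrite [X in (_ < X)%N](bigD1 (lo k)) // (bigD1 (hi k)) ?hi_neq_lo //=.
rewrite !permM spermL spermR !addnA.
have -> : (\sum_(i < n | (i != lo k) && (i != hi k)) (n - i) * (sperm k * s)%g i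
   = \sum_(i < n | (i != lo k) && (i != hi k)) (n - i) * s i)%N.
  by apply: eq_bigr => i /andP[i1 i2]; rewrite permM spermD.
rewrite ltn_add2r; have := ltn_ord (hi k) => /= hk.
have -> : (n - k = (n - k.+1).+1)%N by lia.
nia.
Qed.

Lemma descent_one k : ~~ descent k 1%g.
Proof. by rewrite /descent !perm1 /= -leqNgt leqnSn. Qed.

(** Such an [s] is strictly increasing, hence i <= s i for all i; both sides have the same sum over
    i, so equality holds everywhere. *)
Lemma no_descent (s : 'S_n) : (forall k, ~~ descent k s) -> s = 1%g.
Proof.
move=> h.
have inc (i j : 'I_n) : (i < j)%N -> (s i < s j)%N.
  move=> ij; have [d e] : exists d, j = (i + d.+1)%N :> nat.
    by exists (j - i.+1)%N; lia.
  elim: d j e {ij} => [|d IH] j e.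
    have ki : (i < n.-1)%N by have := ltn_ord j; lia.
    have := h (Ordinal ki); rewrite /descent -leqNgt leq_eqVlt.
    have -> : lo (Ordinal ki) = i by apply: val_inj.
    have -> : hi (Ordinal ki) = j by apply: val_inj; rewrite /= e addn1.
    case/orP => // /eqP /val_inj/perm_inj ij.
    by move: e; rewrite ij; lia.
  have ki : (i + d.+1 < n.-1)%N by have := ltn_ord j; lia.
  have := h (Ordinal ki); rewrite /descent -leqNgt => le.
  have -> : j = hi (Ordinal ki) by apply: val_inj; rewrite /= e addnS.
  apply: leq_trans (IH (lo (Ordinal ki)) _) _ => //.
have ge (i : 'I_n) : (i <= s i)%N.
  case: i => m; elim: m => // m IH mn.
  apply: leq_ltn_trans (IH (ltnW mn)) _; exact: inc.
have eqs : (\sum_(i < n) s i = \sum_(i < n) i)%N.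
  by rewrite [RHS](reindex_inj (@perm_inj _ s)).
apply/permP => i; rewrite perm1; apply/val_inj.
have : (\sum_(i < n) s i <= \sum_(i < n) i)%N by rewrite eqs.
rewrite (bigD1 i) // [X in (_ <= X)%N](bigD1 i) //= => le.
have : (\sum_(j < n | j != i) j <= \sum_(j < n | j != i) s j)%N.
  by apply: leq_sum => j _; apply: ge.
have := ge i; move: le => /=.
set a := (\sum_(j < n | _) s j)%N; set b := (\sum_(j < n | _) j)%N; lia.
Qed.

End Indices.

(* Matsumoto's theorem in the form needed: steps satisfying the commutation and *)
(* braid relations may be composed along any sequence of descents.              *)
Section Diamond.
Variables (n : nat) (V : Type) (P : 'S_n -> V -> Prop).
Variable G : 'I_n.-1 -> 'S_n -> V -> V.
Hypothesis GP : forall k s v, P s v -> P (sperm k * s)%g (G k s v).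
Hypothesis G_far : forall k l s v, far k l -> P s v ->
  G l (sperm k * s)%g (G k s v) = G k (sperm l * s)%g (G l s v).
Hypothesis G_braid : forall (k l : 'I_n.-1) s v, l = k.+1 :> nat -> P s v ->
  G k (sperm l * (sperm k * s))%g (G l (sperm k * s)%g (G k s v)) =
  G l (sperm k * (sperm l * s))%g (G k (sperm l * s)%g (G l s v)).

Lemma diamond v0 : P 1%g v0 ->
  exists u : 'S_n -> V, [/\ u 1%g = v0, forall s, P s (u s) &
    forall k s, descent k s -> u s = G k (sperm k * s)%g (u (sperm k * s)%g)].
Proof.
move=> Pv0.
suff step N : exists u : 'S_n -> V, forall s, (disorder s < N)%N ->
    [/\ s = 1%g -> u s = v0, P s (u s) &
      forall k, descent k s -> u s = G k (sperm k * s)%g (u (sperm k * s)%g)].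
  have [u hu] := step (\max_(s : 'S_n) disorder s).+1.
  have {}hu s := hu s (leq_bigmax s).
  exists u; split=> [|s|k s ds]; first by case: (hu 1%g) => ->.
    by case: (hu s).
  by case: (hu s) => _ _; apply.
elim: N => [|N [u hu]]; first by exists (fun=> v0).
(* The new values go through an arbitrarily picked descent; [confl] below shows that the choice does
   not matter. *)
pose u' s := if (disorder s < N)%N then u s else
  if [pick k | descent k s] is Some k
  then G k (sperm k * s)%g (u (sperm k * s)%g) else v0.
exists u' => s sN.
have small k : descent k s -> (disorder (sperm k * s)%g < N)%N.
  by move/disorder_descent => h; apply: leq_trans h _.
have u'k k : descent k s -> u' (sperm k * s)%g = u (sperm k * s)%g.
  by rewrite /u' => /small ->.
have [lt|ge] := ltnP (disorder s) N.
  have [h1 h2 h3] := hu s lt; rewrite {1 2}/u' lt; split=> // k dk.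
  by rewrite (u'k k dk) /u' lt (h3 k dk).
have us : u' s = if [pick k | descent k s] is Some k
  then G k (sperm k * s)%g (u (sperm k * s)%g) else v0.
  by rewrite /u' ltnNge ge.
case: pickP us => [k dk|nd] us; last first.
  have s1 : s = 1%g by apply: no_descent => k; rewrite nd.
  by rewrite us s1; split=> // k; rewrite (negbTE (descent_one k)).
(* Two descents k and l of [s] lead down to a common permutation, along a square when they are far
   apart and along a hexagon when adjacent. Climbing back from it by either side gives the same
   vector by [G_far] or [G_braid]. *)
have confl l : descent l s ->
    G k (sperm k * s)%g (u (sperm k * s)%g) =
    G l (sperm l * s)%g (u (sperm l * s)%g).
  move=> dl; have [_ Pk uk] := hu _ (small _ dk).
  have [_ Pl ul] := hu _ (small _ dl).
  have braid_case (a b : 'I_n.-1) : b = a.+1 :> nat -> descent a s ->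
      descent b s -> G a (sperm a * s)%g (u (sperm a * s)%g) =
                     G b (sperm b * s)%g (u (sperm b * s)%g).
    move=> ab da db; have eb := lo_next ab.
    have h1 := lo_neq_hi_next ab; have h2 := hi_neq_hi_next ab.
    have ba : sperm b (lo a) = lo a by rewrite spermD ?eb ?lo_neq_hi ?h1.
    have ah : sperm a (hi b) = hi b by rewrite spermD // eq_sym ?h1 ?h2.
    have bh : sperm b (hi a) = hi b by rewrite -eb spermL.
    have hb : sperm b (hi b) = hi a by rewrite -eb spermR.
    have [_ _ ua] := hu _ (small _ da); have [_ _ ub] := hu _ (small _ db).
    have dba : descent b (sperm a * s)%g.
      rewrite /descent !permM ah eb spermR.
      by move: da db; rewrite /descent eb; exact: (fun x y => ltn_trans y x).
    have dab : descent a (sperm b * s)%g.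
      rewrite /descent !permM bh ba.
      by move: da db; rewrite /descent eb; exact: (fun x y => ltn_trans y x).
    have dd1 : descent a (sperm b * (sperm a * s))%g.
      by rewrite /descent !permM bh ba ah spermL; move: db; rewrite /descent eb.
    have dd2 : descent b (sperm a * (sperm b * s))%g.
      by rewrite /descent !permM ah hb eb spermR ba; move: da.
    have sm1 := ltn_trans (disorder_descent dba) (small _ da).
    have sm2 := ltn_trans (disorder_descent dab) (small _ db).
    have [_ _ u1] := hu _ sm1; have [_ _ u2] := hu _ sm2.
    rewrite (ua _ dba) (u1 _ dd1) (ub _ dab) (u2 _ dd2) -(sperm_mul_braid s ab).
    set t := (sperm a * (sperm b * (sperm a * s)))%g.
    have Pt : P t (u t).
      have [] // := hu t; apply: ltn_trans (disorder_descent dd1) sm1.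
    have := G_braid ab Pt; rewrite /t.
    by rewrite 2!sperm_mulK (sperm_mul_braid s ab) 2!sperm_mulK.
  case: (index_cases k l) => [e|e|e|f]; first by rewrite e.
    exact: braid_case.
    by symmetry; apply: braid_case.
  have [h1 h2 h3 h4] := far_neq f.
  have dlk : descent l (sperm k * s)%g.
    by rewrite /descent !permM !spermD // eq_sym.
  have dkl : descent k (sperm l * s)%g.
    by rewrite /descent !permM !spermD.
  rewrite (uk _ dlk) (ul _ dkl) -(sperm_mul_far s f).
  set t := (sperm k * (sperm l * s))%g.
  have tN := ltn_trans (disorder_descent dkl) (small _ dl).
  have [_ Pt _] := hu t tN.
  have := G_far f Pt; rewrite /t sperm_mulK (sperm_mul_far s f).
  by rewrite sperm_mulK.
split=> [s1||l dl].
- by move: dk; rewrite s1 (negbTE (descent_one k)).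
- have [_ Pk _] := hu _ (small _ dk).
  by rewrite us -{1}(sperm_mulK k s); apply: GP.
- by rewrite us u'k // (confl l).
Qed.

End Diamond.

(** * Seminormal coefficients *)

Section Coefficients.
Variables (K : fieldType) (r : nat) (sq : K -> K).
Hypothesis hsq : forall a, sq a ^+ 2 = a.
Implicit Types x y z : (K * 'I_r)%type.

Definition diagc x y : K := if x.2 == y.2 then (y.1 - x.1)^-1 else 0.
Definition offc x y : K :=
  if x.2 == y.2 then sq (1 - diagc x y ^+ 2) else 1.
Definition adm x y : bool :=
  (x.2 != y.2) || [&& x.2 == y.2, y.1 != x.1 + 1 & y.1 != x.1 - 1].

Lemma diagc_anti x y : diagc y x = - diagc x y.
Proof.
rewrite /diagc eq_sym; case: eqP => _; last by rewrite oppr0.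
by rewrite -invrN opprB.
Qed.

Lemma offc_sym x y : offc y x = offc x y.
Proof. by rewrite /offc eq_sym diagc_anti sqrrN. Qed.

Lemma offc_sq x y : offc x y ^+ 2 = 1 - diagc x y ^+ 2.
Proof.
rewrite /offc; case: ifP => h; first by rewrite hsq.
by rewrite /diagc h expr0n subr0 expr1n.
Qed.

Lemma adm_sym x y : adm y x = adm x y.
Proof.
rewrite /adm eq_sym; case: eqP => //= _.
rewrite ![x.1 == _]eq_sym subr_eq [y.1 == x.1 - 1]eq_sym subr_eq.
by rewrite andbC; congr (~~ _ && ~~ _); rewrite eq_sym.
Qed.

Lemma diagc_sq1 x y :
  (diagc x y ^+ 2 == 1) = (x.2 == y.2) && ((y.1 == x.1 + 1) || (y.1 == x.1 - 1)).
Proof.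
rewrite /diagc; case: ifP => _ /=; last by rewrite expr0n eq_sym oner_eq0.
rewrite sqrf_eq1 -[1 in X in X || _]invr1 -[-1 in X in _ || X]invrN1.
by rewrite !(inj_eq invr_inj) !subr_eq addrC [-1 + _]addrC.
Qed.

Lemma offc_neq0 x y : (offc x y != 0) = adm x y.
Proof.
rewrite -sqrf_eq0 offc_sq subr_eq0 eq_sym diagc_sq1 negb_and negb_or.
by rewrite /adm; case: eqP.
Qed.

(** Partial fractions when the three colours agree; otherwise at most one of the three coefficients
    is nonzero, and both sides vanish. *)
Lemma diagc_yang_baxter x y z :
  x <> y -> y <> z -> x <> z ->
  diagc x y * diagc y z = diagc x z * (diagc x y + diagc y z).
Proof.
case: x y z => [x i] [y j] [z k]; rewrite /diagc /= => xy yz xz.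
have [ij|ij] := eqVneq i j; last first.
  rewrite mul0r add0r; case: eqP => ik; rewrite ?mul0r //.
  by rewrite -ik eq_sym (negbTE ij) mulr0.
have [jk|jk] := eqVneq j k; last by rewrite ij (negbTE jk) mulr0 mul0r.
subst j k; rewrite eqxx.
have h1 : y - x != 0 by apply/eqP => /subr0_eq e; case: xy; rewrite e.
have h2 : z - y != 0 by apply/eqP => /subr0_eq e; case: yz; rewrite e.
have h3 : z - x != 0 by apply/eqP => /subr0_eq e; case: xz; rewrite e.
by field; rewrite h1 h2 h3.
Qed.

End Coefficients.

Section BraidDefect.
Variables (K : fieldType) (V : lmodType K).

Let lc (v1 v2 v3 v4 v5 v6 v7 : V) (k1 k2 k3 k4 k5 k6 k7 : K) : V :=
  k1 *: v1 + (k2 *: v2 + (k3 *: v3 + (k4 *: v4 +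
  (k5 *: v5 + (k6 *: v6 + k7 *: v7))))).

(* Expanding both sides of the braid relation in the basis indexed by S_3, all *)
(* coefficients agree except the one of the longest element.                   *)
Lemma braid_defect (F1 F2 : V -> V) (v u1 u2 u12 u21 w1 w2 : V)
    (a b c p p' q q' s : K) :
  linear F1 -> linear F2 ->
  a * b = c * (a + b) -> p * p' = 1 - a ^+ 2 -> q * q' = 1 - b ^+ 2 ->
  F1 v = a *: v + p *: u1 -> F1 u1 = - a *: u1 + p' *: v ->
  F2 v = b *: v + q *: u2 -> F2 u2 = - b *: u2 + q' *: v ->
  F2 u1 = c *: u1 + s *: u21 -> F1 u2 = c *: u2 + s *: u12 ->
  F1 u21 = b *: u21 + q *: w1 -> F2 u12 = a *: u12 + p *: w2 ->
  F1 (F2 (F1 v)) - F2 (F1 (F2 v)) = (p * q * s) *: (w1 - w2).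
Proof.
move=> lin1 lin2 YB pp qq e1 e2 e3 e4 e5 e6 e7 e8.
have F1D x y : F1 (x + y) = F1 x + F1 y by have := lin1 1 x y; rewrite !scale1r.
have F2D x y : F2 (x + y) = F2 x + F2 y by have := lin2 1 x y; rewrite !scale1r.
have F10 : F1 0 = 0 by have := lin1 (-1) 0 0; rewrite scaler0 addr0 scaleN1r addNr.
have F20 : F2 0 = 0 by have := lin2 (-1) 0 0; rewrite scaler0 addr0 scaleN1r addNr.
have F1Z k x : F1 (k *: x) = k *: F1 x by have := lin1 k x 0; rewrite F10 !addr0.
have F2Z k x : F2 (k *: x) = k *: F2 x by have := lin2 k x 0; rewrite F20 !addr0.
pose L := lc v u1 u2 u12 u21 w1 w2.
have LD k1 k2 k3 k4 k5 k6 k7 l1 l2 l3 l4 l5 l6 l7 :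
    L k1 k2 k3 k4 k5 k6 k7 + L l1 l2 l3 l4 l5 l6 l7 =
    L (k1 + l1) (k2 + l2) (k3 + l3) (k4 + l4) (k5 + l5) (k6 + l6) (k7 + l7).
  by rewrite /L /lc !scalerDl; do 6![rewrite addrACA; congr (_ + _)].
have LZ k k1 k2 k3 k4 k5 k6 k7 : k *: L k1 k2 k3 k4 k5 k6 k7 =
    L (k * k1) (k * k2) (k * k3) (k * k4) (k * k5) (k * k6) (k * k7).
  by rewrite /L /lc !scalerDr !scalerA.
have E1 k : k *: v = L k 0 0 0 0 0 0 by rewrite /L /lc !scale0r !addr0.
have E2 k : k *: u1 = L 0 k 0 0 0 0 0 by rewrite /L /lc !scale0r !addr0 !add0r.
have E3 k : k *: u2 = L 0 0 k 0 0 0 0 by rewrite /L /lc !scale0r !addr0 !add0r.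
have E4 k : k *: u12 = L 0 0 0 k 0 0 0 by rewrite /L /lc !scale0r !addr0 !add0r.
have E5 k : k *: u21 = L 0 0 0 0 k 0 0 by rewrite /L /lc !scale0r !addr0 !add0r.
have E6 k : k *: w1 = L 0 0 0 0 0 k 0 by rewrite /L /lc !scale0r !addr0 !add0r.
have E7 k : k *: w2 = L 0 0 0 0 0 0 k by rewrite /L /lc !scale0r !add0r.
rewrite scalerBr -[- (F2 _)]scaleN1r -[- (_ *: w2)]scaleN1r.
rewrite !(e1, e2, e3, e4, e5, e6, e7, e8, F1D, F2D, F1Z, F2Z).
rewrite !(E1, E2, E3, E4, E5, E6, E7, LD, LZ).
by congr (L _ _ _ _ _ _ _); ring: YB pp qq.
Qed.

End BraidDefect.

(** * Modules and intertwiners *)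

Lemma sum_expr_unity_root (K : fieldType) (r : nat) (z : K) :
  z ^+ r = 1 -> z != 1 -> \sum_(s < r) z ^+ s = 0.
Proof.
move=> zr z1; have /eqP := subrX1 z r; rewrite zr subrr eq_sym mulf_eq0.
by rewrite subr_eq0 (negbTE z1) => /eqP.
Qed.

(** The sum is geometric with ratio [zeta ^+ i / zeta ^+ j], an r-th root of unity. Divided by r, it
    is the scalar by which e_k acts on a weight vector: 1 if the two colours agree, 0 otherwise. *)
Lemma sum_prim_root_pair (K : fieldType) (r : nat) (zeta : K) (i j : 'I_r) :
  r.-primitive_root zeta ->
  \sum_(s < r) (zeta ^+ i) ^+ s * (zeta ^+ j) ^+ (r - s) = (r * (i == j))%:R.
Proof.
move=> hz; have zr := prim_expr_order hz.
have r_gt0 := prim_order_gt0 hz.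
have z0 : zeta != 0.
  by apply/eqP => z0; move: zr; rewrite z0 expr0n gtn_eqF // => /esym/eqP;
     rewrite oner_eq0.
have zj : zeta ^+ j != 0 by rewrite expf_neq0.
have zjr : (zeta ^+ j) ^+ r = 1 by rewrite exprAC zr expr1n.
have -> : \sum_(s < r) (zeta ^+ i) ^+ s * (zeta ^+ j) ^+ (r - s) =
    \sum_(s < r) (zeta ^+ i / zeta ^+ j) ^+ s.
  apply: eq_bigr => s _; rewrite expr_div_n; congr (_ * _).
  by apply: (mulIf (expf_neq0 s zj)); rewrite -exprD subnK ?mulVf ?expf_neq0 1?ltnW.
have [->|ij] := eqVneq i j.
  by rewrite divff // (eq_bigr (fun=> 1)) => [|s _]; rewrite ?expr1n //
     sumr_const card_ord muln1.
rewrite muln0; apply: sum_expr_unity_root.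
  by rewrite expr_div_n zjr divr1 exprAC zr expr1n.
apply: contraNneq ij => /divr1_eq /eqP; rewrite (eq_prim_root_expr hz).
by rewrite !modn_small.
Qed.

Section Evaluation.
Variables (K : fieldType) (r n : nat) (V : vectType K).
Variables (T X : 'I_n -> 'End(V)) (F : 'I_n.-1 -> 'End(V)).

Fixpoint deval (u : dterm K n) : 'End(V) :=
  match u with
  | DScal c => c *: \1%VF
  | DT i => T i
  | DF k => F k
  | DX i => X i
  | DAdd u v => deval u + deval v
  | DMul u v => (deval u \o deval v)%VF
  end.

Lemma deval_cong u v : (forall u' v', drel r u' v' -> deval u' = deval v') ->
  dcong r u v -> deval u = deval v.
Proof.
move=> hrel; elim=> {u v} //=.
- by move=> v u w _ -> _ ->.
- by move=> u u' v v' _ -> _ ->.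
- by move=> u u' v v' _ -> _ ->.
- by move=> u v w; rewrite addrA.
- by move=> u v; rewrite addrC.
- by move=> u; rewrite scale0r add0r.
- by move=> u; rewrite -comp_lfunZl comp_lfun1l scaleN1r addNr scale0r.
- by move=> u v w; rewrite comp_lfunA.
- by move=> u; rewrite scale1r comp_lfun1l.
- by move=> u v w; rewrite comp_lfunDl.
- by move=> u v w; rewrite comp_lfunDr.
- by move=> a b; rewrite scalerDl.
- by move=> a b; rewrite -comp_lfunZl comp_lfun1l scalerA.
- by move=> a u; rewrite -comp_lfunZl -comp_lfunZr comp_lfun1l comp_lfun1r.
Qed.

Lemma deval_expT i m (z : K) v :
  T i v = z *: v -> deval (dexp (DT K i) m) v = z ^+ m *: v.
Proof.
move=> Tv; elim: m => [|m IH]; first by rewrite /= lfunE /= id_lfunE expr0.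
by rewrite /= comp_lfunE IH linearZ /= Tv scalerA -exprSr.
Qed.

Lemma deval_de (zeta : K) (k : 'I_n.-1) (a b : 'I_r) v :
  r.-primitive_root zeta -> r%:R != 0 :> K ->
  T (lo k) v = zeta ^+ a *: v -> T (hi k) v = zeta ^+ b *: v ->
  deval (de K r k) v = (a == b)%:R *: v.
Proof.
move=> hz r0 Ta Tb; rewrite /de /= comp_lfunE lfunE /= id_lfunE.
rewrite (big_morph deval (id1 := 0) (op1 := +%R)) //; last first.
  by rewrite /= scale0r.
rewrite sum_lfunE (eq_bigr (fun s : 'I_r =>
  ((zeta ^+ a) ^+ s * (zeta ^+ b) ^+ (r - s)) *: v)); last first.
  move=> s _; rewrite /= comp_lfunE (deval_expT _ Tb) linearZ /=.
  by rewrite (deval_expT _ Ta) scalerA mulrC.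
by rewrite -scaler_suml sum_prim_root_pair // scalerA natrM mulKf.
Qed.

End Evaluation.

Section Construction.
Variables (K : fieldType) (r n : nat) (V : vectType K).
Variables (T X : 'I_n -> 'End(V)) (F : 'I_n.-1 -> 'End(V)).
Hypothesis rel : forall u v, drel r u v -> deval T X F u = deval T X F v.

Let act (a : Drn K r n) := deval T X F (drepr a).

Lemma deval_repr u : act (dclass r u) = deval T X F u.
Proof. exact: deval_cong rel (dreprP _ _). Qed.

Lemma deval_linear : linear act.
Proof.
move=> c a b; rewrite -[a]dreprK -[b]dreprK.
have -> : c *: dclass r (drepr a) = dclass r (DMul (DScal n c) (drepr a)).
  by rewrite dclassM dclassS mulr_algl.
by rewrite -dclassD !deval_repr /= -comp_lfunZl comp_lfun1l.
Qed.

Lemma deval_one v : act 1 v = v.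
Proof.
have -> : 1 = dclass r (DScal n 1) :> Drn K r n by [].
by rewrite deval_repr /= scale1r id_lfunE.
Qed.

Lemma deval_mul a b v : act (a * b) v = act a (act b v).
Proof.
rewrite -[a]dreprK -[b]dreprK -dclassM !deval_repr /=.
by rewrite comp_lfunE.
Qed.

Definition Dmodule_of_ops : Dmodule K r n :=
  DModule deval_linear deval_one deval_mul.

Lemma Dmodule_of_opsT i : dact Dmodule_of_ops (tgen K r i) = T i.
Proof. exact: deval_repr. Qed.

Lemma Dmodule_of_opsX i : dact Dmodule_of_ops (xgen K r i) = X i.
Proof. exact: deval_repr. Qed.

Lemma Dmodule_of_opsF k : dact Dmodule_of_ops (fgen K r k) = F k.
Proof. exact: deval_repr. Qed.

End Construction.


Section ModuleTheory.
Variables (K : fieldType) (r n : nat).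
Implicit Types M N : Dmodule K r n.

Lemma dactD M a b v : dact M (a + b) v = dact M a v + dact M b v.
Proof. by have := @dact_linear _ _ _ M 1 a b; rewrite !scale1r => ->; rewrite lfunE. Qed.

Lemma dact0 M v : dact M 0 v = 0.
Proof.
have := @dact_linear _ _ _ M (-1) 0 0.
by rewrite scaler0 addr0 scaleN1r addNr => ->; rewrite zero_lfunE.
Qed.

Lemma dactZ M c a v : dact M (c *: a) v = c *: dact M a v.
Proof.
have := @dact_linear _ _ _ M c a 0; rewrite addr0 => ->.
by rewrite lfunE /= lfunE /= dact0 addr0.
Qed.

Lemma dact_scal M c v : dact M (c%:A) v = c *: v.
Proof. by rewrite dactZ dact1. Qed.

(** This reduces claims about the action of all of D_{r,n} to the generators, by induction on
    expressions. *)
Lemma dact_dclass M u :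
  dact M (dclass r u) = deval (fun i => dact M (tgen K r i))
    (fun i => dact M (xgen K r i)) (fun k => dact M (fgen K r k)) u.
Proof.
elim: u => //= [c|u IHu v IHv|u IHu v IHv].
- by apply/lfunP => v; rewrite dclassS dact_scal lfunE /= id_lfunE.
- by rewrite -IHu -IHv; apply/lfunP => w; rewrite dclassD dactD lfunE.
- by rewrite -IHu -IHv; apply/lfunP => w; rewrite dclassM dactM comp_lfunE.
Qed.

Lemma Dhom_of_gens M N (phi : 'Hom(M, N)) :
  (forall i v, phi (dact M (tgen K r i) v) = dact N (tgen K r i) (phi v)) ->
  (forall i v, phi (dact M (xgen K r i) v) = dact N (xgen K r i) (phi v)) ->
  (forall k v, phi (dact M (fgen K r k) v) = dact N (fgen K r k) (phi v)) ->
  forall a v, phi (dact M a v) = dact N a (phi v).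
Proof.
move=> ht hx hf a; rewrite -[a]dreprK !dact_dclass; move: (drepr a).
elim=> //= [c|u IHu v IHv|u IHu v IHv] w.
- by rewrite !lfunE /= !id_lfunE linearZ.
- by rewrite !lfunE /= linearD /= IHu IHv.
- by rewrite !comp_lfunE IHu IHv.
Qed.

Lemma submodule_of_gens M (U : {vspace M}) :
  (forall i v, v \in U -> dact M (tgen K r i) v \in U) ->
  (forall i v, v \in U -> dact M (xgen K r i) v \in U) ->
  (forall k v, v \in U -> dact M (fgen K r k) v \in U) ->
  forall a v, v \in U -> dact M a v \in U.
Proof.
move=> ht hx hf a; rewrite -[a]dreprK !dact_dclass; move: (drepr a).
elim=> //= [c|u IHu v IHv|u IHu v IHv] w wU.
- by rewrite !lfunE /= !id_lfunE memvZ.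
- by rewrite lfunE /= memvD ?IHu ?IHv.
- by rewrite comp_lfunE IHu ?IHv.
Qed.

Definition ent (w : Dweight K r n) (i : 'I_n) := (w.1 i, w.2 i).

Lemma ent_inj w w' : ent w =1 ent w' -> w = w'.
Proof.
case: w w' => [a i] [b j] h; congr (_, _); apply/ffunP => x.
  by have [] := h x.
by have [] := h x.
Qed.

Definition permw (s : 'S_n) (w : Dweight K r n) : Dweight K r n :=
  ([ffun i => w.1 (s i)], [ffun i => w.2 (s i)]).

Lemma ent_perm s w i : ent (permw s w) i = ent w (s i).
Proof. by rewrite /ent /= !ffunE. Qed.

Lemma ent_swap k w i : ent (swapw k w) i = ent w (sperm k i).
Proof. by rewrite /ent /= !ffunE. Qed.

Lemma swapwK k : involutive (@swapw K r n k).
Proof. by move=> w; apply: ent_inj => i; rewrite !ent_swap spermK. Qed.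

Lemma swap_permw k s w : swapw k (permw s w) = permw (sperm k * s)%g w.
Proof. by apply: ent_inj => i; rewrite ent_swap !ent_perm permM. Qed.

Lemma permw1 w : permw 1%g w = w.
Proof. by apply: ent_inj => i; rewrite ent_perm perm1. Qed.

Lemma admE k (w : Dweight K r n) :
  admissible k w = adm (ent w (lo k)) (ent w (hi k)).
Proof. by []. Qed.

End ModuleTheory.

Section Weights.
Variables (K : fieldType) (r n : nat) (zeta : K) (M : Dmodule K r n).
Hypothesis hzeta : r.-primitive_root zeta.
Hypothesis r_neq0 : r%:R != 0 :> K.

Local Notation t i := (dact M (tgen K r i)).
Local Notation x i := (dact M (xgen K r i)).
Local Notation f k := (dact M (fgen K r k)).

Lemma drel_act u v (m : M) : drel r u v ->
  dact M (dclass r u) m = dact M (dclass r v) m.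
Proof. by move/dclass_rel ->. Qed.

Lemma act_ff k l v : far k l -> f k (f l v) = f l (f k v).
Proof. by move/(@drel_ff K r n) => h; rewrite -!dactM -!dclassM (drel_act _ h). Qed.

Lemma act_braid (k l : 'I_n.-1) v : l = k.+1 :> nat ->
  f k (f l (f k v)) = f l (f k (f l v)).
Proof.
by move/(@drel_braid K r n)/drel_act => /(_ v); rewrite !dclassM !dactM.
Qed.

Lemma act_f2 k v : f k (f k v) = v.
Proof.
rewrite -dactM -dclassM (drel_act _ (drel_f2 K r k)) dclassS.
by rewrite dact_scal scale1r.
Qed.

Lemma act_tt i j v : t i (t j v) = t j (t i v).
Proof. by rewrite -!dactM -!dclassM (drel_act _ (drel_tt K r i j)). Qed.

Lemma act_xx i j v : x i (x j v) = x j (x i v).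
Proof. by rewrite -!dactM -!dclassM (drel_act _ (drel_xx K r i j)). Qed.

Lemma act_tx i j v : t j (x i v) = x i (t j v).
Proof. by rewrite -!dactM -!dclassM (drel_act _ (drel_tx K r i j)). Qed.

Lemma act_ft k j v : f k (t j v) = t (sperm k j) (f k v).
Proof. by rewrite -!dactM -!dclassM (drel_act _ (drel_ft K r k j)). Qed.

Lemma act_fx_far k j v : j != lo k -> j != hi k -> f k (x j v) = x j (f k v).
Proof.
by move=> h1 h2; rewrite -!dactM -!dclassM (drel_act _ (drel_fx_far K r h1 h2)).
Qed.

Lemma act_fx k v :
  f k (x (hi k) v) = x (lo k) (f k v) + dact M (dclass r (de K r k)) v.
Proof.
rewrite -!dactM -!dclassM (drel_act _ (drel_fx K r k)) dclassD dactD.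
by rewrite dclassM.
Qed.

Lemma act_tr i v : iter r (t i) v = v.
Proof.
have it m : iter m (t i) v = dact M (dclass r (dexp (DT K i) m)) v.
  elim: m => [|m IH] /=; first by rewrite dclassS dact_scal scale1r.
  by rewrite dclassM dactM IH.
by rewrite it (drel_act _ (drel_tr K r i)) dclassS dact_scal scale1r.
Qed.

Definition wt (w : Dweight K r n) (v : M) : Prop := forall i,
  t i v = zeta ^+ w.2 i *: v /\ x i v = w.1 i *: v.

Lemma wt_lc w a u v : wt w u -> wt w v -> wt w (a *: u + v).
Proof.
move=> hu hv i; have [tu xu] := hu i; have [tv xv] := hv i.
by rewrite !linearP /= tu tv xu xv.
Qed.

Lemma wt0 w : wt w 0.
Proof. by move=> i; rewrite !linear0. Qed.

Lemma wtZ w a v : wt w v -> wt w (a *: v).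
Proof. by move=> hv; rewrite -[_ *: _]addr0; apply: wt_lc => //; apply: wt0. Qed.

Lemma act_e w k v : wt w v ->
  dact M (dclass r (de K r k)) v = (w.2 (lo k) == w.2 (hi k))%:R *: v.
Proof.
move=> hv; rewrite dact_dclass; apply: (deval_de _ _ hzeta) => //.
  by case: (hv (lo k)).
by case: (hv (hi k)).
Qed.

Lemma act_t_f w k v j : wt w v ->
  t j (f k v) = zeta ^+ w.2 (sperm k j) *: f k v.
Proof.
by move=> hv; rewrite -{1}(spermK k j) -act_ft; case: (hv (sperm k j)) => -> _;
   rewrite linearZ.
Qed.

Lemma act_x_lo_f w k v : wt w v ->
  x (lo k) (f k v) = w.1 (hi k) *: f k v - (w.2 (lo k) == w.2 (hi k))%:R *: v.
Proof.
move=> hv; have := act_fx k v; rewrite (act_e _ hv).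
by case: (hv (hi k)) => _ ->; rewrite linearZ /= => ->; rewrite addrK.
Qed.

(** Conjugating the relation between f_k and x_{k+1} by f_k, an involution, gives the companion
    relation; e_k acts on [f k v] with the two colours exchanged. *)
Lemma act_x_hi_f w k v : wt w v ->
  x (hi k) (f k v) = w.1 (lo k) *: f k v + (w.2 (lo k) == w.2 (hi k))%:R *: v.
Proof.
move=> hv; rewrite -[LHS](act_f2 k) act_fx act_f2 linearD /=.
congr (_ + _); first by case: (hv (lo k)) => _ ->; rewrite linearZ.
rewrite dact_dclass (deval_de (a := w.2 (hi k)) (b := w.2 (lo k)) _ _ hzeta) //.
- by rewrite linearZ /= act_f2 eq_sym.
- by rewrite (act_t_f _ _ hv) spermL.
- by rewrite (act_t_f _ _ hv) spermR.
Qed.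

Lemma act_x_f w k v j : wt w v -> j != lo k -> j != hi k ->
  x j (f k v) = w.1 j *: f k v.
Proof.
by move=> hv h1 h2; rewrite -act_fx_far //; case: (hv j) => _ ->; rewrite linearZ.
Qed.

Variable sq : K -> K.
Hypothesis hsq : forall a, sq a ^+ 2 = a.

Local Notation A w k := (diagc (ent w (lo k)) (ent w (hi k))).

Lemma wt_intertwiner w k v : wt w v -> ent w (lo k) <> ent w (hi k) ->
  wt (swapw k w) (f k v - A w k *: v).
Proof.
move=> hv neq j.
have op (Y : 'End(M)) : Y (f k v - A w k *: v) = Y (f k v) - A w k *: Y v.
  by rewrite linearB linearZ.
rewrite !op !ffunE.
have [tj xj] := hv j; split.
  rewrite (act_t_f _ _ hv) tj scalerBr; congr (_ - _).
  rewrite /diagc /=; case: eqP => [e|_]; last by rewrite !scale0r scaler0.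
  rewrite !scalerA mulrC; congr (_ ^+ _ * _ *: _); congr (nat_of_ord _).
  have [->|j1] := eqVneq j (lo k); first by rewrite spermL.
  have [->|j2] := eqVneq j (hi k); first by rewrite spermR.
  by rewrite spermD.
(* Distinctness of the entries makes the inverse in [diagc] a genuine one; this identity cancels the
   inhomogeneous term of x f. *)
have Adef : A w k * (w.1 (hi k) - w.1 (lo k)) = (w.2 (lo k) == w.2 (hi k))%:R.
  rewrite /diagc /=; case: eqP => [e|_]; last by rewrite mul0r.
  rewrite mulVf // subr_eq0; apply/eqP => e'; apply: neq.
  by rewrite /ent e e'.
have [jl|j1] := eqVneq j (lo k).
  move: xj; rewrite jl spermL => ->; rewrite (act_x_lo_f _ hv) -Adef.
  rewrite scalerBr !scalerA -addrA -opprD -scalerDl.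
  by congr (_ - _ *: _); ring.
have [jh|j2] := eqVneq j (hi k).
  move: xj; rewrite jh spermR => ->; rewrite (act_x_hi_f _ hv) -Adef.
  rewrite scalerBr !scalerA -addrA -scalerBl.
  by rewrite -scaleNr; congr (_ + _ *: _); ring.
by rewrite spermD // (act_x_f hv) // xj scalerBr !scalerA mulrC.
Qed.

(** Semisimplicity of x_i in the form used below: a vector killed by (x_i - a)^2 is already killed
    by x_i - a. *)
Hypothesis x_ss : forall i a v,
  x i (x i v - a *: v) = a *: (x i v - a *: v) -> x i v = a *: v.

(** If both entries were (a, c), then (x_k - a) f_k v = - v and (x_k - a) v = 0, so f_k v and v
    would span a Jordan block of size 2. *)
Lemma wt_ent_neq w k v : wt w v -> v != 0 -> ent w (lo k) <> ent w (hi k).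
Proof.
move=> hv v0 [e1 e2]; have := act_x_lo_f k hv; rewrite e2 eqxx scale1r -e1 => h.
have /x_ss : x (lo k) (x (lo k) (f k v) - w.1 (lo k) *: f k v) =
   w.1 (lo k) *: (x (lo k) (f k v) - w.1 (lo k) *: f k v).
  rewrite h addrC addKr linearN /= scalerN.
  by case: (hv (lo k)) => _ ->.
rewrite h => /eqP; rewrite -subr_eq0 addrC addKr oppr_eq0.
by rewrite (negbTE v0).
Qed.

Definition normc (y z : K * 'I_r) : K :=
  if offc sq y z == 0 then 1 else offc sq y z.

Lemma normc_neq0 y z : normc y z != 0.
Proof. by rewrite /normc; case: ifP => [_|->//]; rewrite oner_eq0. Qed.

Lemma normc_sym y z : normc y z = normc z y.
Proof. by rewrite /normc offc_sym. Qed.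

Local Notation B w k := (normc (ent w (lo k)) (ent w (hi k))).

(* The normalisation never vanishes, so that [phi] loses no information even at *)
(* inadmissible transpositions.                                                 *)
Definition phi k w v : M :=
  (normc (ent w (lo k)) (ent w (hi k)))^-1 *:
    (f k v - diagc (ent w (lo k)) (ent w (hi k)) *: v).

Lemma phi0 k w : phi k w 0 = 0.
Proof. by rewrite /phi linear0 scaler0 subr0 scaler0. Qed.

Lemma phi_wt k w v : wt w v -> wt (swapw k w) (phi k w v).
Proof.
have [->|v0] := eqVneq v 0; first by rewrite phi0 => _; apply: wt0.
by move=> hv; apply/wtZ/wt_intertwiner => //; apply: wt_ent_neq hv v0.
Qed.

Lemma f_phi k w v : f k v =
  diagc (ent w (lo k)) (ent w (hi k)) *: v +
  normc (ent w (lo k)) (ent w (hi k)) *: phi k w v.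
Proof. by rewrite /phi scalerA divff ?normc_neq0 // scale1r addrC subrK. Qed.

(** The diagonal coefficient changes sign with the weight, and (f + a)(f - a) = 1 - a^2 because f^2
    = 1. *)
Lemma phi_phi k w v : phi k (swapw k w) (phi k w v) =
  ((normc (ent w (lo k)) (ent w (hi k)))^-2 *
   (1 - diagc (ent w (lo k)) (ent w (hi k)) ^+ 2)) *: v.
Proof.
have b0 := normc_neq0 (ent w (lo k)) (ent w (hi k)).
have := f_phi k w v; move: (phi k w v) => u; rewrite [phi k _ _]/phi.
rewrite !ent_swap spermL spermR (normc_sym (ent w (hi k))).
rewrite (diagc_anti (ent w (lo k))) scaleNr opprK.
move: (diagc _ _) (normc _ _) b0 => a b b0 fv.
have e : b *: (f k u + a *: u) = (1 - a ^+ 2) *: v.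
  have := act_f2 k v; rewrite fv linearD !linearZ /= fv => h.
  rewrite scalerBl scale1r -{1}h !scalerDr !scalerA -expr2 [b * a]mulrC.
  by rewrite [RHS]addrC -[_ + b *: f k u]addrA addKr addrC.
apply: (scalerI b0); rewrite scalerA divff // scale1r.
apply: (scalerI b0); rewrite e !scalerA; congr (_ *: _); by field.
Qed.

(** If the entries at k and k+2 agreed, either intertwiner would make them adjacent, so both would
    kill v by [wt_ent_neq]. Then f_k v = a v and f_{k+1} v = - a v with a^2 = 1, while the braid
    relation forces 2 a^3 = 0. *)
Lemma wt_ent_neq_next (k l : 'I_n.-1) w v : l = k.+1 :> nat -> 2%:R != 0 :> K ->
  wt w v -> v != 0 -> ent w (lo k) <> ent w (hi l).
Proof.
move=> e two0 hv v0 xz; have el := lo_next e.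
have h1 := lo_neq_hi_next e; have h2 := hi_neq_hi_next e.
have fk : f k v = A w k *: v.
  rewrite (f_phi k w v).
  have [->|p0] := eqVneq (phi k w v) 0; first by rewrite scaler0 addr0.
  case: (@wt_ent_neq _ l _ (phi_wt k hv) p0).
  by rewrite el !ent_swap spermR xz spermD // eq_sym ?h1 ?h2.
have fl : f l v = - A w k *: v.
  rewrite -diagc_anti (f_phi l w v) el -xz.
  have [->|p0] := eqVneq (phi l w v) 0; first by rewrite scaler0 addr0.
  case: (@wt_ent_neq _ k _ (phi_wt l hv) p0).
  by rewrite !ent_swap -el spermL -xz spermD ?el ?lo_neq_hi ?h1.
move: (diagc _ _) fk fl => a fk fl.
have a2 : a ^+ 2 = 1.
  have := act_f2 k v; rewrite fk linearZ /= fk scalerA -expr2 => /eqP.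
  by rewrite -subr_eq0 -[X in _ - X]scale1r -scalerBl scaler_eq0 (negbTE v0)
     orbF subr_eq0 => /eqP.
have op (Y : 'End(M)) c p : Y (c *: p) = c *: Y p by rewrite linearZ.
have := act_braid v e; rewrite !(fk, fl, op) !scalerA => /eqP.
rewrite -subr_eq0 -scalerBl scaler_eq0 (negbTE v0) orbF => /eqP h.
have : 2%:R * a ^+ 2 * a == 0 by apply/eqP; rewrite -oppr0 -{}h; ring.
rewrite a2 mulr1 mulf_eq0 (negbTE two0) /= => /eqP a0.
by move/eqP: a2; rewrite a0 expr0n eq_sym oner_eq0.
Qed.

Lemma phi_far k l w v : far k l ->
  phi l (swapw k w) (phi k w v) = phi k (swapw l w) (phi l w v).
Proof.
move=> kl; have [h1 h2 h3 h4] := far_neq kl.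
rewrite /phi !ent_swap !(@spermD _ k) 1?eq_sym // !(@spermD _ l) //.
move: (diagc _ _) (normc _ _) (diagc _ _) (normc _ _) => c d a b.
have op (Y : 'End(M)) e p q g : Y (e *: (p - g *: q)) = e *: (Y p - g *: Y q).
  by rewrite linearZ linearB linearZ.
rewrite !op (act_ff _ kl).
have comm (g e : K) (p : M) : g *: (e *: p) = e *: (g *: p).
  by rewrite !scalerA mulrC.
rewrite [c *: (_ *: _)]comm [a *: (_ *: _)]comm -!scalerBr [d^-1 *: _]comm.
congr (_ *: (_ *: _)).
rewrite !scalerBr [a *: (c *: _)]comm !opprB !addrA.
by rewrite addrAC [RHS]addrAC; congr (_ + _); rewrite addrAC.
Qed.

Lemma phi_braid (k l : 'I_n.-1) w v : l = k.+1 :> nat -> 2%:R != 0 :> K ->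
  wt w v ->
  phi k (swapw l (swapw k w)) (phi l (swapw k w) (phi k w v)) =
  phi l (swapw k (swapw l w)) (phi k (swapw l w) (phi l w v)).
Proof.
move=> e two0 hv; have [->|v0] := eqVneq v 0; first by rewrite !phi0.
have el := lo_next e.
have h1 := lo_neq_hi_next e; have h2 := hi_neq_hi_next e.
have lk : sperm l (lo k) = lo k by rewrite spermD ?el ?lo_neq_hi ?h1.
have kl : sperm k (hi l) = hi l by rewrite spermD // eq_sym ?h1 ?h2.
have lh : sperm l (hi k) = hi l by rewrite -el spermL.
have hl : sperm l (hi l) = hi k by rewrite -el spermR.
have sE := (ent_swap, spermL, spermR, kl, lk, lh, hl, el).
have xy := @wt_ent_neq w k v hv v0.
have yz := @wt_ent_neq w l v hv v0; rewrite el in yz.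
have xz := wt_ent_neq_next e two0 hv v0.
have YB := diagc_yang_baxter xy yz xz.
have N0 := normc_neq0.
apply/eqP; rewrite -subr_eq0; apply/eqP.
have pqs0 : normc (ent w (lo k)) (ent w (hi k)) *
    normc (ent w (hi k)) (ent w (hi l)) *
    normc (ent w (lo k)) (ent w (hi l)) != 0 by rewrite !mulf_neq0 ?N0.
(* The multiplier is the coefficient p q s of [braid_defect], nonzero by the choice of [normc]. The
   two extreme vectors are therefore equal as soon as the braid relation of the f's makes the defect
   zero. *)
apply: (scalerI pqs0); rewrite scaler0.
have lin (Y : 'End(M)) : linear Y by move=> a p q; rewrite linearP.
have quad y z : normc y z * ((normc y z)^-1 * (1 - diagc y z ^+ 2)) =
    1 - diagc y z ^+ 2 by rewrite mulVKf.
have inv_sq y z (b : K) : normc z y * (normc y z ^- 2 * b) = (normc y z)^-1 * b.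
  by rewrite normc_sym; field; exact: N0.
rewrite -(braid_defect (lin (f k)) (lin (f l)) YB (quad _ _) (quad _ _)
  (v := v) (u1 := phi k w v) (u2 := phi l w v)
  (u12 := phi k (swapw l w) (phi l w v))
  (u21 := phi l (swapw k w) (phi k w v))).
- by rewrite (act_braid v e) subrr.
- exact: f_phi.
- rewrite (f_phi k (swapw k w)) phi_phi !sE -diagc_anti; congr (_ + _).
  by rewrite scalerA inv_sq.
- by rewrite {1}(f_phi l w) el.
- rewrite (f_phi l (swapw l w)) phi_phi !sE -diagc_anti; congr (_ + _).
  by rewrite scalerA inv_sq.
- by rewrite (f_phi l (swapw k w)) !sE.
- by rewrite (f_phi k (swapw l w)) !sE.
- by rewrite (f_phi k (swapw l (swapw k w))) !sE.
- by rewrite (f_phi l (swapw k (swapw l w))) !sE.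
Qed.

End Weights.

(** * Weights *)

Section Diagonalizable.
Variables (K : fieldType) (V : vectType K).

Lemma coord_basis_inj (b : seq V) (u v : V) : basis_of fullv b ->
  (forall i, coord (in_tuple b) i u = coord (in_tuple b) i v) -> u = v.
Proof.
move=> bb h; rewrite (@coord_basis _ _ fullv _ (in_tuple b) u) ?memvf //.
rewrite [RHS](@coord_basis _ _ fullv _ (in_tuple b) v) ?memvf //.
by apply: eq_bigr => i _; rewrite h.
Qed.

(** In an eigenbasis, each coordinate c with eigenvalue e satisfies (e - a)^2 c = 0, hence (e - a) c
    = 0. *)
Lemma diagonalizable_square_zero (Y : 'End(V)) a v : lfun_diagonalizable Y ->
  Y (Y v - a *: v) = a *: (Y v - a *: v) -> Y v = a *: v.
Proof.
case=> b bb eig; set bt := in_tuple b.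
have eigc i : exists e, forall u, coord bt i (Y u) = e * coord bt i u.
  have [e he] := eig _ (mem_nth 0 (ltn_ord i)).
  exists e => u; rewrite {1}(@coord_basis _ _ fullv _ bt u) ?memvf //.
  rewrite !linear_sum /= (bigD1 i) //= big1 ?addr0 => [|j ji].
    rewrite !linearZ /= he linearZ /= coord_free ?(basis_free bb) // eqxx mulr1.
    exact: mulrC.
  have [e' he'] := eig _ (mem_nth 0 (ltn_ord j)).
  rewrite !linearZ /= he' linearZ /= coord_free ?(basis_free bb) //.
  by rewrite (negbTE ji) !mulr0.
move=> h; apply: (coord_basis_inj bb) => i; have [e he] := eigc i.
have cB p q k : coord bt i (p - k *: q) = coord bt i p - k * coord bt i q.
  by rewrite linearB linearZ.
have cZ k p : coord bt i (k *: p) = k * coord bt i p by rewrite linearZ.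
rewrite he cZ; move/(congr1 (coord bt i)): h; rewrite he cZ cB he => h.
move: h; set c := coord _ _ _ => /eqP; rewrite -subr_eq0 -mulrBl -mulrBl mulrA.
rewrite mulf_eq0 -expr2 expf_eq0 /=.
by case/orP=> [/eqP/subr0_eq->//|/eqP->]; rewrite !mulr0.
Qed.

End Diagonalizable.

Section Eigenvectors.
Variables (K : closedFieldType) (V : vectType K).

Lemma closed_eigenvector (Y : 'End(V)) (U : {vspace V}) :
  U != 0%VS -> (forall v, v \in U -> Y v \in U) ->
  exists2 v, v \in U & v != 0 /\ exists a, Y v = a *: v.
Proof.
move=> U0 YU; set b := vbasis U; have bb : basis_of U b := vbasisP U.
pose A : 'M[K]_(\dim U) := \matrix_(i, j) coord b j (Y b`_i).
have bU (i : 'I_(\dim U)) : b`_i \in U.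
  by apply: vbasis_mem; rewrite mem_nth // size_tuple.
have : size (char_poly A) != 1%N by rewrite size_char_poly eqSS dimv_eq0.
case/closed_rootP=> a; rewrite -eigenvalue_root_char => /eigenvalueP[u uA u0].
exists (\sum_i u 0 i *: b`_i); first by apply: memv_suml => i _; rewrite memvZ.
split.
  apply: contra u0 => /eqP s0; apply/eqP/rowP => i; rewrite mxE.
  exact: (freeP (basis_free bb) (fun i => u 0 i) s0 i).
exists a; rewrite linear_sum scaler_sumr /=.
rewrite (eq_bigr (fun i => \sum_j (u 0 i * A i j) *: b`_j)) => [|i _].
  rewrite exchange_big; apply: eq_bigr => j _ /=; rewrite -scaler_suml scalerA.
  by move/rowP/(_ j): uA; rewrite !mxE => <-.
rewrite linearZ /= {1}(coord_basis bb (YU _ (bU i))) scaler_sumr.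
by apply: eq_bigr => j _; rewrite mxE scalerA.
Qed.

(** Induction on the list: an eigenspace of the first operator in [U] is stable under the others,
    which commute with it. *)
Lemma closed_common_eigenvector (ys : seq 'End(V)) (U : {vspace V}) :
  U != 0%VS -> (forall y, y \in ys -> forall v, v \in U -> y v \in U) ->
  (forall y z, y \in ys -> z \in ys -> forall v, y (z v) = z (y v)) ->
  exists2 v, v \in U & v != 0 /\ forall y, y \in ys -> exists a, y v = a *: v.
Proof.
elim: ys U => [|y ys IH] U U0 st comm.
  by exists (vpick U); [exact: memv_pick | rewrite vpick0].
have [v vU [v0 [a ya]]] := closed_eigenvector U0 (st y (mem_head _ _)).
pose U' := (U :&: lker (y - a *: \1%VF))%VS.
have inU' u : (u \in U') = (u \in U) && (y u == a *: u).
  rewrite memv_cap memv_ker add_lfunE opp_lfunE scale_lfunE id_lfunE.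
  by rewrite subr_eq0.
have vU' : v \in U' by rewrite inU' vU ya eqxx.
have U'0 : U' != 0%VS.
  by apply: contra v0 => /eqP e; move: vU'; rewrite e memv0.
have [||u] := IH U' U'0.
- move=> z zs u; rewrite !inU' => /andP[uU /eqP yu].
  rewrite st ?inE ?zs ?orbT //= comm ?inE ?eqxx ?zs ?orbT //.
  by rewrite yu linearZ.
- by move=> z z' hz hz'; apply: comm; rewrite inE ?hz ?hz' orbT.
rewrite inU' => /andP[uU /eqP yu] [u0 hu]; exists u => //; split=> // z.
by rewrite inE => /orP[/eqP->|/hu//]; exists a.
Qed.

End Eigenvectors.

Section Separation.
Variables (K : fieldType) (r n : nat) (zeta : K).
Hypothesis hzeta : r.-primitive_root zeta.

Lemma separating_generator (w w' : Dweight K r n) : w != w' ->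
  exists (y : Drn K r n) (e : Dweight K r n -> K), e w != e w' /\
    forall (M : Dmodule K r n) u v, wt zeta (M := M) u v -> dact M y v = e u *: v.
Proof.
move=> ww'; have [i wi] : exists i, ent w i != ent w' i.
  apply: contrapT => h; case/negP: ww'; apply/eqP/ent_inj => i.
  by apply/eqP/negPn/negP => hi; apply: h; exists i.
have [e1|n1] := eqVneq (w.1 i) (w'.1 i); last first.
  exists (xgen K r i), (fun u : Dweight K r n => u.1 i); split=> // M u v huv.
  by case: (huv i).
exists (tgen K r i), (fun u : Dweight K r n => zeta ^+ u.2 i); split=> [|M u v huv].
  rewrite (eq_prim_root_expr hzeta) !modn_small //.
  by apply: contra wi => /eqP/val_inj e2; rewrite /ent e1 e2.
by case: (huv i).
Qed.

(** An interpolation product: each weight w1 of [s] other than w contributes a factor (y - e w1) /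
    (e w - e w1), where y is a generator that distinguishes the two. The same algebra element serves
    every module. *)
Lemma separating_element (w : Dweight K r n) (s : seq (Dweight K r n)) :
  exists (a : Drn K r n) (c : Dweight K r n -> K), [/\ c w = 1,
    forall w', w' \in s -> w' != w -> c w' = 0 &
    forall (M : Dmodule K r n) u v, wt zeta (M := M) u v -> dact M a v = c u *: v].
Proof.
elim: s => [|w1 s [a [c [cw cs ca]]]].
  by exists 1, (fun=> 1); split=> // M u v _; rewrite dact1 scale1r.
have [->|ww1] := eqVneq w1 w.
  by exists a, c; split=> // w'; rewrite inE => /orP[/eqP->|/cs//]; rewrite eqxx.
have [y [e [ne hy]]] := separating_generator ww1.
exists (a * ((e w - e w1)^-1 *: (y - (e w1)%:A))).
exists (fun u => c u * ((e w - e w1)^-1 * (e u - e w1))); split.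
- by rewrite cw mul1r mulVf // subr_eq0 eq_sym.
- move=> w'; rewrite inE => /orP[/eqP-> _|hs hw]; last by rewrite cs // mul0r.
  by rewrite subrr !mulr0.
- move=> M u v huv; rewrite dactM dactZ dactD -scaleNr dact_scal (hy _ _ _ huv).
  by rewrite -scalerDl scalerA linearZ /= (ca _ _ _ huv) scalerA mulrC.
Qed.

End Separation.

Section WeightSpaces.
Variables (K : fieldType) (r n : nat) (zeta : K) (M : Dmodule K r n).
Hypothesis x_ss : forall i a (v : M),
  dact M (xgen K r i) (dact M (xgen K r i) v - a *: v) =
  a *: (dact M (xgen K r i) v - a *: v) -> dact M (xgen K r i) v = a *: v.

(** Under semisimplicity generalised eigenvectors of x_i are eigenvectors: [x_ss] lowers the
    exponent N by one as long as it is at least 2. *)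
Lemma wt_weight_space w (m : M) : in_weight_space zeta w m <-> wt zeta w m.
Proof.
pose Y i := (dact M (xgen K r i) - w.1 i *: \1)%VF.
have YE i v : Y i v = dact M (xgen K r i) v - w.1 i *: v.
  by rewrite /Y add_lfunE opp_lfunE scale_lfunE id_lfunE.
split=> h i.
  have [[N0 hN] ht] := h i; split.
    apply/eqP; rewrite -subr_eq0 -[in X in _ - X](scale1r (zeta ^+ _ *: m)).
    by move: ht; rewrite add_lfunE opp_lfunE scale_lfunE id_lfunE scale1r => ->.
  have := hN N0 (leqnn _); elim: N0 {hN} => [|N IH] /=.
    by move=> ->; rewrite linear0 scaler0.
  case: N IH => [|N] IH.
    by rewrite /= -/(Y i) YE => /eqP; rewrite subr_eq0 => /eqP.
  rewrite -/(Y i) iterS => hN; apply: IH; rewrite iterS -/(Y i).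
  move: hN; set u := iter N _ m; rewrite !YE => /eqP; rewrite subr_eq0 => /eqP.
  by move/x_ss => ->; rewrite subrr.
have [ht hx] := h i; split.
  exists 1%N => [[//|N]] _; rewrite iterSr -/(Y i) YE hx subrr.
  by elim: N => //= N ->; rewrite linear0.
by rewrite add_lfunE opp_lfunE scale_lfunE id_lfunE ht subrr.
Qed.

Lemma RepI_weightI w (v : M) : RepI M -> wt zeta w v -> v != 0 -> weightI w.
Proof.
move=> hI hv v0 i; apply: (hI i); rewrite /passmx.leigenvalue /passmx.leigenspace.
apply: contra v0 => /eqP k0; rewrite -memv0 -k0 memv_ker.
rewrite add_lfunE opp_lfunE scale_lfunE id_lfunE.
by case: (hv i) => _ ->; rewrite subrr.
Qed.

End WeightSpaces.

(** The t_i and x_i commute and so have a common eigenvector; as t_i^r = 1, the eigenvalues of the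
    t_i are powers of zeta. *)
Lemma exists_weight (K : closedFieldType) (r n : nat) (zeta : K)
    (M : Dmodule K r n) :
  r.-primitive_root zeta -> fullv != 0%VS :> {vspace M} ->
  exists w, exists2 v : M, v != 0 & wt zeta w v.
Proof.
move=> hz M0.
pose ys := [seq dact M (tgen K r i) | i <- enum 'I_n] ++
           [seq dact M (xgen K r i) | i <- enum 'I_n].
have [||v _ [v0 hv]] := @closed_common_eigenvector _ _ ys _ M0.
- by move=> *; rewrite memvf.
- move=> y z; rewrite !mem_cat => /orP[]/mapP[i _ ->] /orP[]/mapP[j _ ->] v.
  + exact: act_tt.
  + exact: act_tx.
  + by rewrite act_tx.
  + exact: act_xx.
have tE i : exists j : 'I_r, dact M (tgen K r i) v = zeta ^+ j *: v.
  have [|a ta] := hv (dact M (tgen K r i)).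
    by rewrite mem_cat; apply/orP; left; apply/mapP; exists i; rewrite ?mem_enum.
  suff /(prim_rootP hz)[j ea] : a ^+ r = 1 by exists j; rewrite ta ea.
  have it m : iter m (dact M (tgen K r i)) v = a ^+ m *: v.
    elim: m => [|m IH] /=; first by rewrite scale1r.
    by rewrite IH linearZ /= ta scalerA exprSr.
  have := act_tr i v; rewrite it => /eqP.
  by rewrite -subr_eq0 -{2}[v]scale1r -scalerBl scaler_eq0 (negbTE v0) orbF
     subr_eq0 => /eqP.
have xE i : exists a, dact M (xgen K r i) v = a *: v.
  apply: hv; rewrite mem_cat; apply/orP; right; apply/mapP; exists i => //.
  by rewrite mem_enum.
have [j hj] := choice tE; have [a ha] := choice xE.
by exists ([ffun i => a i], [ffun i => j i]), v => // i; rewrite !ffunE.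
Qed.

(** * Irreducible completely splittable modules *)

Section OrderPreserving.
Variables (K : fieldType) (r n : nat).
Implicit Types (w : Dweight K r n) (s t : 'S_n) (i j : 'I_n) (k : 'I_n.-1).

(** The pair (k, k+1) is the only inversion of s_k. *)
Lemma sperm_lt k i j : (i < j)%N ->
  (sperm k i < sperm k j)%N || ((i == lo k) && (j == hi k)).
Proof.
move=> ij; rewrite /sperm; case: tpermP => [ei|ei|/eqP i1 /eqP i2];
  case: tpermP => [ej|ej|/eqP j1 /eqP j2]; rewrite ?ei ?ej ?eqxx ?orbT //=;
  move: ij; rewrite ?ei ?ej; try move: i1 i2; try move: j1 j2;
  rewrite -?val_eqE /=; lia.
Qed.

(** Equal entries of [w] keep their relative order when [w] is rearranged by [s]. These [s] are the
    distinguished representatives of the cosets of the stabiliser of [w]. *)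
Definition ordpres w s := forall i j, (i < j)%N ->
  ent (permw s w) i = ent (permw s w) j -> (s i < s j)%N.

(** The permutation [t] must take the value [s i] at a position later than i, and the entry there
    equals the one at i. At the first disagreement of [s] and [t], this applied both ways gives t i
    < s i < t i. *)
Lemma ordpres_step w s t i : permw s w = permw t w -> ordpres w t ->
  (forall j, (j < i)%N -> s j = t j) -> s i != t i -> (t i < s i)%N.
Proof.
move=> st ot IH neq; set i2 := (t^-1)%g (s i); have ti2 : t i2 = s i by rewrite permKV.
have [lt|gt|e] := ltngtP i i2.
- by rewrite -ti2; apply: ot => //; rewrite -{1}st !ent_perm ti2.
- by move: (IH _ gt); rewrite ti2 => /perm_inj e; rewrite e ltnn in gt.
- by case/negP: neq; rewrite {2}(val_inj e) ti2.
Qed.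

Lemma ordpres_inj w s t :
  ordpres w s -> ordpres w t -> permw s w = permw t w -> s = t.
Proof.
move=> os ot st; apply/permP => i; move: {2}(i : nat).+1 (ltnSn i) => m.
elim: m i => // m IH i im; apply/eqP/negPn/negP => neq.
have IHi j : (j < i)%N -> s j = t j by move=> ji; apply: IH; apply: leq_trans ji _.
have h1 := ordpres_step st ot IHi neq.
have h2 := ordpres_step (esym st) os (fun j h => esym (IHi j h)).
by move: h1; rewrite ltnNge ltnW // h2 // eq_sym.
Qed.

End OrderPreserving.

Section Irreducible.
Variables (K : fieldType) (r n : nat) (zeta : K) (M : Dmodule K r n).
Hypothesis hzeta : r.-primitive_root zeta.
Hypothesis r_neq0 : r%:R != 0 :> K.
Hypothesis two_neq0 : 2%:R != 0 :> K.
Hypothesis x_ss : forall i a (v : M),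
  dact M (xgen K r i) (dact M (xgen K r i) v - a *: v) =
  a *: (dact M (xgen K r i) v - a *: v) -> dact M (xgen K r i) v = a *: v.
Variable sq : K -> K.
Hypothesis hsq : forall a, sq a ^+ 2 = a.

Local Notation t i := (dact M (tgen K r i)).
Local Notation x i := (dact M (xgen K r i)).
Local Notation f k := (dact M (fgen K r k)).
Local Notation wt := (wt zeta (M := M)).
Local Notation phi := (phi (M := M) sq).
Local Notation A w k := (diagc (ent w (lo k)) (ent w (hi k))).
Local Notation B w k := (offc sq (ent w (lo k)) (ent w (hi k))).
Local Notation N w k := (normc sq (ent w (lo k)) (ent w (hi k))).
Implicit Types (w : Dweight K r n) (u v m : M) (k l : 'I_n.-1).

Let wt_neq w k v : wt w v -> v != 0 -> ent w (lo k) <> ent w (hi k).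
Proof. exact: wt_ent_neq. Qed.

Let phi_weight k w v : wt w v -> wt (swapw k w) (phi k w v).
Proof. exact: phi_wt. Qed.

Lemma phi_scal w k : (N w k)^-2 * (1 - A w k ^+ 2) = (B w k != 0)%:R.
Proof.
rewrite -(offc_sq hsq) /normc; case: eqP => [->|/eqP b0].
  by rewrite expr0n mulr0.
by rewrite mulVf // expf_neq0.
Qed.

Lemma phiK k w v : phi k (swapw k w) (phi k w v) = (B w k != 0)%:R *: v.
Proof. by rewrite phi_phi phi_scal. Qed.

Lemma phi_neq0 k w v : B w k != 0 -> v != 0 -> phi k w v != 0.
Proof.
move=> b0; apply: contraNneq => p0; have := phiK k w v.
by rewrite b0 scale1r p0 phi0 => <-.
Qed.

Lemma phi_family w v : wt w v -> exists u : 'S_n -> M,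
  [/\ u 1%g = v, forall s, wt (permw s w) (u s) &
    forall k s, descent k s ->
      u s = phi k (permw (sperm k * s)%g w) (u (sperm k * s)%g)].
Proof.
move=> hv; apply: (@diamond n M (fun s v => wt (permw s w) v)
  (fun k s v => phi k (permw s w) v)).
- by move=> k s u hu; rewrite -swap_permw; apply: phi_weight.
- by move=> k l s u kl hu; rewrite -!swap_permw phi_far.
- move=> k l s u kl hu; rewrite -!swap_permw.
  exact: (phi_braid hzeta r_neq0 sq x_ss kl two_neq0 hu).
- by rewrite permw1.
Qed.

Section Family.
Variables (w : Dweight K r n) (u : 'S_n -> M).
Hypothesis u_wt : forall s, wt (permw s w) (u s).
Hypothesis u_desc : forall k s, descent k s ->
  u s = phi k (permw (sperm k * s)%g w) (u (sperm k * s)%g).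

(** Along an ascent this is a defining step of the family; along a descent [phi] undoes the last
    step, up to the scalar 0 or 1 of [phiK]. *)
Lemma phi_on_family k s : phi k (permw s w) (u s) =
  (if descent k s then (B (permw s w) k != 0)%:R else 1) *: u (sperm k * s)%g.
Proof.
case: ifP => [ds|/negbT ds]; last first.
  by rewrite scale1r (@u_desc k (sperm k * s)%g) ?descent_swap // sperm_mulK.
have -> : permw s w = swapw k (permw (sperm k * s)%g w).
  by rewrite swap_permw sperm_mulK.
rewrite (u_desc ds) phiK !ent_swap spermL spermR.
by rewrite [in RHS]offc_sym.
Qed.

(** Going up by s_k reverses no pair but (k, k+1), and if its two entries were equal then
    [wt_ent_neq] would give [u s = 0]. *)
Lemma family_ordpres s : u s != 0 -> ordpres w s.
Proof.
move: {2}(disorder s).+1 (ltnSn (disorder s)) => d.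
elim: d s => // d IH s sd us.
case: (pickP (fun k => descent k s)) => [k dk|nd]; last first.
  by rewrite (@no_descent _ s) => [|k]; [move=> i j; rewrite !perm1 | rewrite nd].
have us' : u (sperm k * s)%g != 0.
  by apply: contra us => /eqP e; rewrite (u_desc dk) e phi0.
have os := IH _ (leq_trans (disorder_descent dk) sd) us'.
move=> i j ij; rewrite !ent_perm => eij.
case/orP: (sperm_lt k ij) => [lt|/andP[/eqP ei /eqP ej]].
  have := os _ _ lt; rewrite !ent_perm !permM !spermK; exact.
case: (wt_neq (k := k) (u_wt s) us).
by rewrite !ent_perm -ei -ej.
Qed.

Hypothesis irr : Dirreducible M.
Hypothesis u1 : u 1%g != 0.

(** By [f_phi] and [phi_on_family], the span is a submodule; it is nonzero, so irreducibility
    applies. *)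
Lemma family_span : <<[seq u s | s <- enum 'S_n]>>%VS = fullv.
Proof.
set U := span _; have inU s : u s \in U by rewrite memv_span ?map_f ?mem_enum.
have step (Y : 'End(M)) : (forall s, Y (u s) \in U) ->
    forall v, v \in U -> Y v \in U.
  move=> h v vU; have : (Y @: U <= U)%VS.
    rewrite limg_span; apply/span_subvP => m /mapP[v' /mapP[s _ ->] ->].
    exact: h.
  by move/subvP; apply; apply: memv_img.
have st := @submodule_of_gens _ _ _ M U.
have [|U0|//] := irr.2 U.
  move=> a; apply/subvP => m /memv_imgP[v vU ->]; apply: st vU.
  - by move=> i; apply: step => s; case: (u_wt s i) => -> _; rewrite memvZ.
  - by move=> i; apply: step => s; case: (u_wt s i) => _ ->; rewrite memvZ.
  - move=> k; apply: step => s; rewrite (f_phi sq k (permw s w)).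
    by rewrite phi_on_family !memvD ?memvZ.
by case/negP: u1; rewrite -memv0 -U0.
Qed.

(** The element separating w' fixes m but kills every [u s], hence all of M. *)
Lemma family_weight w' m : wt w' m ->
  (forall s, permw s w = w' -> u s = 0) -> m = 0.
Proof.
move=> hm hu.
have [a [c [cw cs ca]]] := separating_element hzeta w'
  [seq permw s w | s <- enum 'S_n].
rewrite -[m]scale1r -cw -(ca _ _ _ hm); apply/eqP; rewrite -memv_ker.
have : m \in (fullv : {vspace M}) by rewrite memvf.
apply/subvP; rewrite -family_span; apply/span_subvP => v /mapP[s _ ->].
rewrite memv_ker (ca _ _ _ (u_wt s)).
have [e|ne] := eqVneq (permw s w) w'; first by rewrite (hu _ e) scaler0.
by rewrite cs ?scale0r //; apply/mapP; exists s; rewrite ?mem_enum.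
Qed.

End Family.

Hypothesis irr : Dirreducible M.

(* If [phi k w v] were nonzero it would generate [M], but the only vector of    *)
(* weight [w] reachable from it is [phi k (phi k v) = 0].                        *)
Lemma phi_inadmissible k w v : wt w v -> B w k = 0 -> phi k w v = 0.
Proof.
move=> hv b0; apply/eqP/negPn/negP => p0.
have v0 : v != 0 by apply: contra p0 => /eqP ->; rewrite phi0.
have [u [u1 u_wt u_desc]] := phi_family (phi_weight k hv).
case/eqP: v0; apply: (family_weight u_wt u_desc irr _ hv); first by rewrite u1.
move=> s sw; apply/eqP/negPn/negP => us.
have ss : permw (sperm k * 1)%g (swapw k w) = w.
  by rewrite -swap_permw permw1 swapwK.
(* The permutation s_k reverses only the entries k and k+1 of w, which differ because v is nonzero.
   By [ordpres_inj], it is then the only index that can contribute to weight w. *)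
have os : ordpres (swapw k w) (sperm k * 1)%g.
  move=> i j ij; rewrite ss !permM !perm1 => eij.
  case/orP: (sperm_lt k ij) => // /andP[/eqP ei /eqP ej].
  case: (wt_neq (k := k) hv) => [|]; last by rewrite -ei -ej.
  by apply: contra p0 => /eqP ->; rewrite phi0.
have es := ordpres_inj (family_ordpres u_wt u_desc us) os (etrans sw (esym ss)).
case/negP: us; rewrite es (u_desc k) ?descent_swap ?descent_one //.
by rewrite sperm_mulK u1 permw1 phiK b0 eqxx scale0r.
Qed.

Lemma f_seminormal k w v : wt w v ->
  f k v = A w k *: v + B w k *: phi k w v.
Proof.
move=> hv; rewrite (f_phi sq k w) /normc; case: eqP => // b0.
by rewrite (phi_inadmissible hv b0) !scaler0.
Qed.

Definition weight_of w := exists2 v : M, v != 0 & wt w v.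

Lemma weight_of_swap k w : adm (ent w (lo k)) (ent w (hi k)) ->
  weight_of w -> weight_of (swapw k w).
Proof.
rewrite -(offc_neq0 hsq) => b0 [v v0 hv].
by exists (phi k w v); [exact: phi_neq0 | exact: phi_weight].
Qed.

(** Induction on j - i, with w varying. If the entry at i can be moved right or the one at j moved
    left by an admissible transposition, the interval shrinks. Otherwise both inner neighbours
    differ from the end entries by 1 or -1, with the same colour, and only the case where both
    differ by -e remains. *)
Lemma weight_of_between w (i j : 'I_n) (e : K) : e = 1 \/ e = -1 ->
  weight_of w -> (i < j)%N -> ent w i = ent w j ->
  exists l : 'I_n, [/\ (i < l)%N, (l < j)%N & ent w l = (w.1 i + e, w.2 i)].
Proof.
move=> he; move: {2}(j - i)%N.+1 (ltnSn (j - i)%N) => d.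
elim: d w i j => // d IH w i j dij ww ij eij.
have [v v0 hv] := ww.
have j_gt0 : (0 < j)%N := leq_ltn_trans (leq0n i) ij.
have ki : (i < n.-1)%N by rewrite ltn_predRL (leq_ltn_trans ij).
have kj : (j.-1 < n.-1)%N by rewrite ltn_predRL prednK.
pose k := Ordinal ki; pose l := Ordinal kj.
have lok : lo k = i by apply: val_inj.
have hil : hi l = j by apply: val_inj; rewrite /= prednK.
have hk : hi k = i.+1 :> nat by [].
have ll : (lo l).+1 = j :> nat by rewrite /= prednK.
have nk : hi k != j.
  by apply/eqP => hkj; case: (wt_neq (k := k) hv v0); rewrite lok hkj.
have nkl : hi k != lo l.
  apply/eqP => /(congr1 val) hl; have lk1 : l = k.+1 :> nat by [].
  case: (wt_ent_neq_next hzeta r_neq0 sq x_ss lk1 two_neq0 hv v0).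
  by rewrite lok hil.
have nil : i != lo l.
  by apply: contra nk => /eqP il; apply/eqP/val_inj; rewrite -[RHS]ll -il.
have nih : i != hi l by rewrite hil -val_eqE ltn_eqF.
have njl : j != lo k by rewrite lok -val_eqE gtn_eqF.
have njh : j != hi k by rewrite eq_sym.
have lil : (i < lo l)%N.
  by rewrite ltn_neqAle nil -ltnS ll.
have lkl : (hi k < lo l)%N by rewrite ltn_neqAle nkl hk.
have lkj : (hi k < j)%N by rewrite -ll ltnS ltnW.
have shrink (a b : nat) : (i <= a)%N -> (b <= j)%N -> (i < a)%N || (b < j)%N ->
    (a < b)%N -> (b - a < d)%N.
  by move: dij; clear; lia.
have [a1|] := boolP (adm (ent w (lo k)) (ent w (hi k))).
  have [||m [m1 m2 m3]] := IH _ (hi k) j _ (weight_of_swap a1 ww) lkj.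
  - by apply: shrink; rewrite ?hk ?ltnSn ?leqnSn.
  - by rewrite !ent_swap spermR lok (spermD njl njh).
  have im : (i < m)%N by rewrite ltnW // -hk.
  have nml : m != lo k by rewrite lok -val_eqE gtn_eqF.
  have nmh : m != hi k by rewrite -val_eqE gtn_eqF.
  exists m; split=> //; move: m3; rewrite ent_swap (spermD nml nmh) => ->.
  by rewrite /= !ffunE spermR lok.
have [a2|na2 na1] := boolP (adm (ent w (lo l)) (ent w (hi l))).
  have [||m [m1 m2 m3] _] := IH _ i (lo l) _ (weight_of_swap a2 ww) lil.
  - by apply: shrink; rewrite // -ll ?leqnSn ?ltnSn ?orbT.
  - by rewrite !ent_swap spermL (spermD nil nih) eij hil.
  have mj : (m < j)%N by rewrite -ll ltnS ltnW.
  have nml : m != lo l by rewrite -val_eqE ltn_eqF.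
  have nmh : m != hi l by rewrite hil -val_eqE ltn_eqF.
  exists m; split=> //; move: m3; rewrite ent_swap (spermD nml nmh) => ->.
  by rewrite /= !ffunE (spermD nil nih).
have near (y z : K * 'I_r) : ~~ adm y z -> z = (y.1 + e, y.2) \/ z = (y.1 - e, y.2).
  case: y z => [a b] [c g]; rewrite /adm /= negb_or negbK => /andP[/eqP->].
  rewrite eqxx /= negb_and !negbK => h.
  by case: he h => -> /orP[]/eqP->; rewrite ?opprK; auto.
rewrite lok in na1; rewrite hil -eij in na2.
have {}na2 : ~~ adm (ent w i) (ent w (lo l)) by rewrite adm_sym.
have [e1|e1] := near _ _ na1; first by exists (hi k); rewrite hk ltnSn -hk.
have [e2|e2] := near _ _ na2; first by exists (lo l); rewrite lil -ll ltnSn.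
(* Both neighbours are w_i - e. Between them the induction hypothesis finds an entry equal to that
   at i, and between i and this new position it then finds w_i + e. *)
have [||m [m1 m2 m3]] := IH _ (hi k) (lo l) _ ww lkl.
- by apply: shrink; rewrite ?hk ?leqnSn ?ltnSn // -ll leqnSn.
- by rewrite e1 e2.
have mi : ent w m = ent w i.
  by rewrite m3; case: e1; rewrite /ent /= => -> ->; rewrite subrK.
have im : (i < m)%N by rewrite ltnW // -hk.
have mj : (m < j)%N by rewrite -ll ltnS ltnW.
have [||m' [h1 h2 h3]] := IH _ i m _ ww im.
- by apply: shrink; rewrite ?mj ?orbT // ltnW.
- by rewrite mi.
by exists m'; split=> //; apply: ltn_trans h2 mj.
Qed.

Lemma weight_of_Cont w : RepI M -> weight_of w -> Cont w.
Proof.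
move=> hI ww; split; first by case: ww => v v0 hv; apply: RepI_weightI hI hv v0.
move=> i j ij e1 e2 a ha.
have eij : ent w i = ent w j by rewrite /ent e1 e2.
have [e ae he] : exists2 e, a = w.1 i + e & e = 1 \/ e = -1.
  by case: ha => ->; [exists 1; auto | exists (-1); auto].
have [l [l1 l2 [l3 l4]]] := weight_of_between he ww ij eij.
by exists l; split=> //; rewrite ae.
Qed.

End Irreducible.

(** * Comparison with the seminormal module *)

Lemma wequiv_step (K : fieldType) (r n : nat) (w w' : Dweight K r n) k :
  wequiv w w' -> admissible k w' -> wequiv w (swapw k w').
Proof.
case=> s ps -> ak; exists (rcons s (swapw k (last w s))).
  by rewrite rcons_path ps /=; apply/existsP; exists k; rewrite ak eqxx.
by rewrite last_rcons.
Qed.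

Lemma wequiv_ind (K : fieldType) (r n : nat) (w : Dweight K r n)
    (P : Dweight K r n -> Prop) : P w ->
  (forall k w', P w' -> admissible k w' -> P (swapw k w')) ->
  forall w', wequiv w w' -> P w'.
Proof.
move=> Pw step w' [s + ->]; elim/last_ind: s => //= s y IH.
rewrite rcons_path last_rcons => /andP[/IH Ps /existsP[k /andP[ak /eqP->]]].
exact: step.
Qed.

Section SeminormalForm.
Variables (K : fieldType) (r n : nat) (zeta : K) (sq : K -> K).
Variables (D : Dmodule K r n) (lam : set (Dweight K r n)).
Variable v : Dweight K r n -> D.
Hypothesis act : seminormal_action zeta sq lam v.

Lemma seminormal_wt w : lam w -> wt zeta w (v w).
Proof. by move/act => -[h _] i; case: (h i). Qed.

Lemma seminormal_f w k : lam w -> dact D (fgen K r k) (v w) =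
  diagc (ent w (lo k)) (ent w (hi k)) *: v w +
  offc sq (ent w (lo k)) (ent w (hi k)) *: v (swapw k w).
Proof.
move/act => -[_ /(_ k) /= [h1 h2]]; rewrite /diagc /offc /=.
case: eqP => [e|ne]; last by rewrite scale0r add0r scale1r h1.
rewrite h2 //; congr (_ *: _ + _ *: v _).
  by rewrite /diagc /= e eqxx.
congr (_, _); apply/ffunP => i; rewrite ffunE /sperm.
by case: tpermP => [->|->|//]; rewrite e.
Qed.

End SeminormalForm.

Section Uniqueness.
Variables (K : fieldType) (r n : nat) (zeta : K) (M : Dmodule K r n).
Hypothesis hzeta : r.-primitive_root zeta.
Hypothesis r_neq0 : r%:R != 0 :> K.
Hypothesis two_neq0 : 2%:R != 0 :> K.
Hypothesis x_ss : forall i a (v : M),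
  dact M (xgen K r i) (dact M (xgen K r i) v - a *: v) =
  a *: (dact M (xgen K r i) v - a *: v) -> dact M (xgen K r i) v = a *: v.
Variable sq : K -> K.
Hypothesis hsq : forall a, sq a ^+ 2 = a.
Hypothesis irr : Dirreducible M.

Variables (D : Dmodule K r n) (lam : set (Dweight K r n)).
Variable v : Dweight K r n -> D.
Hypothesis D_irr : Dirreducible D.
Hypothesis D_basis : is_lam_basis lam v.
Hypothesis D_act : seminormal_action zeta sq lam v.

(** Schur's lemma: the kernel and the image of g are submodules. *)
Lemma Diso_of_hom (g : 'Hom(D, M)) :
  (forall a u, g (dact D a u) = dact M a (g u)) -> (exists u, g u != 0) ->
  Diso M D.
Proof.
move=> hg [u gu].
have ker0 : lker g == 0%VS.
  have [|->//|kf] := D_irr.2 (lker g).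
    move=> a; apply/subvP => m /memv_imgP[m' hm' ->].
    by rewrite memv_ker hg; move: hm'; rewrite memv_ker => /eqP->; rewrite linear0.
  have : u \in lker g by rewrite kf memvf.
  by rewrite memv_ker (negbTE gu).
have img : limg g = fullv.
  have [|i0|//] := irr.2 (limg g).
    move=> a; apply/subvP => m /memv_imgP[m' /memv_imgP[m'' _ ->] ->].
    by rewrite -hg memv_img ?memvf.
  have : g u \in limg g by rewrite memv_img ?memvf.
  by rewrite i0 memv0 (negbTE gu).
have gK := lker0_lfunK ker0.
have gVK : cancel (g^-1)%VF g by move=> m; rewrite limg_lfunVK // img memvf.
exists (g^-1)%VF; first by exists g.
by move=> a m; apply: (can_inj gK); rewrite hg !gVK.
Qed.

(** The map sends v_w to the nonzero family member of weight w, whose index is unique by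
    [ordpres_inj]. By that uniqueness an admissible s_k carries family members to family members
    exactly as it does the basis of D. *)
Lemma Diso_of_weight w0 v0 : (forall w, weight_of zeta M w -> Cont w) ->
  wt (M := M) zeta w0 v0 -> v0 != 0 ->
  lam = [set w' | Cont w' /\ wequiv w0 w']%classic -> Diso M D.
Proof.
move=> hC hv0 v00 lamE.
have [u [u1 u_wt u_desc]] := phi_family hzeta r_neq0 two_neq0 x_ss sq hv0.
have [s [s_uniq sP s_basis]] := D_basis.
have swapE w k t : permw t w0 = w -> u t != 0 ->
    offc sq (ent w (lo k)) (ent w (hi k)) != 0 ->
    phi sq k w (u t) = u (sperm k * t)%g /\ u (sperm k * t)%g != 0.
  move=> tw ut b0; have e : phi sq k w (u t) = u (sperm k * t)%g.
    by rewrite -tw (phi_on_family hsq u_desc) tw b0 if_same scale1r.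
  by split; rewrite // -e; apply: (phi_neq0 hsq).
have reach w : wequiv w0 w -> exists t, u t != 0 /\ permw t w0 = w.
  move: w; apply: wequiv_ind => [|k w [t [ut tw]] ak].
    by exists 1%g; rewrite u1 permw1.
  exists (sperm k * t)%g; rewrite -swap_permw tw; split=> //.
  by have [] := swapE _ k _ tw ut; rewrite // offc_neq0.
have lam_reach w : lam w -> exists t, u t != 0 /\ permw t w0 = w.
  by rewrite lamE => -[_ /reach].
pose tau w := odflt 1%g [pick t | (u t != 0) && (permw t w0 == w)].
have tauP w t : u t != 0 -> permw t w0 = w -> tau w = t.
  move=> ut tw; rewrite /tau; case: pickP => [t' /andP[ut' /eqP tw']|/(_ t)].
    apply: (ordpres_inj (w := w0)); last by rewrite tw tw'.
      exact: (family_ordpres hzeta r_neq0 x_ss u_wt u_desc ut').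
    exact: (family_ordpres hzeta r_neq0 x_ss u_wt u_desc ut).
  by rewrite ut tw eqxx.
pose b := in_tuple [seq v w | w <- s].
pose gf (m : D) : M := \sum_i coord b i m *: u (tau (nth w0 s i)).
have gf_lin : linear gf.
  move=> a x y; rewrite /gf scaler_sumr -big_split /=; apply: eq_bigr => i _.
  by rewrite linearP scalerDl scalerA.
pose gL : {linear D -> M} := HB.pack gf (GRing.isLinear.Build _ _ _ _ gf gf_lin).
pose g := linfun gL.
have g_v w : lam w -> g (v w) = u (tau w).
  move=> /sP ws; rewrite /g lfunE /= /gf.
  have iw : (index w s < size [seq v w | w <- s])%N by rewrite size_map index_mem.
  have vw : v w = b`_(Ordinal iw).
    by rewrite /= (nth_map w0) ?index_mem // nth_index.
  have cf j : coord b j (v w) = (Ordinal iw == j)%:R.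
    by rewrite vw coord_free ?(basis_free s_basis).
  rewrite (bigD1 (Ordinal iw)) //= big1 => [|j ji].
    by rewrite addr0 cf eqxx scale1r nth_index.
  by rewrite cf eq_sym (negbTE ji) scale0r.
have ext (Y : 'End(D)) (Z : 'End(M)) :
    (forall w, lam w -> g (Y (v w)) = Z (g (v w))) -> forall m, g (Y m) = Z (g m).
  move=> h m; suff /lfunP/(_ m) : (g \o Y)%VF = (Z \o g)%VF by rewrite !comp_lfunE.
  apply/(fullv_lfunP _ _ (span_basis s_basis)) => x /mapP[w /sP lw ->].
  by rewrite !comp_lfunE h.
have lam_wt w : lam w -> exists t, [/\ u t != 0, permw t w0 = w & tau w = t].
  by move=> /lam_reach[t [ut tw]]; exists t; split=> //; apply: tauP.
apply: (@Diso_of_hom g); last first.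
  exists (v w0); have lw0 : lam w0.
    rewrite lamE; split; first by apply: hC; exists v0.
    by exists [::].
  rewrite g_v // (tauP w0 1%g) ?u1 ?permw1 //.
apply: Dhom_of_gens => [i|i|k]; apply: ext => w lw.
- have [hw _] := seminormal_wt D_act lw i; rewrite hw linearZ /= g_v //.
  have [t [ut tw ->]] := lam_wt w lw.
  by case: (u_wt t i); rewrite tw => ->.
- have [_ hw] := seminormal_wt D_act lw i; rewrite hw linearZ /= g_v //.
  have [t [ut tw ->]] := lam_wt w lw.
  by case: (u_wt t i); rewrite tw => _ ->.
- rewrite (seminormal_f D_act) // linearD !linearZ /= g_v //.
  have [t [ut tw tau_w]] := lam_wt w lw; rewrite tau_w.
  have wtw : wt (M := M) zeta w (u t) by rewrite -tw.
  rewrite (f_seminormal hzeta r_neq0 two_neq0 x_ss hsq irr k wtw).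
  congr (_ + _); have [->|b0] := eqVneq (offc sq (ent w (lo k)) (ent w (hi k))) 0; first by rewrite !scale0r.
  have [-> us] := swapE w k t tw ut b0.
  have sw : permw (sperm k * t)%g w0 = swapw k w by rewrite -swap_permw tw.
  rewrite g_v ?(tauP _ _ us sw) // lamE; split.
    by apply: hC; exists (u (sperm k * t)%g) => //; rewrite -sw; apply: u_wt.
  move: lw; rewrite lamE => -[_ hw]; apply: wequiv_step => //.
  by rewrite admE -(offc_neq0 hsq).
Qed.

End Uniqueness.

(** * Content vectors and the seminormal modules *)

Section ContentVectors.
Variables (K : fieldType) (r n : nat).
Implicit Types (w : Dweight K r n) (k l : 'I_n.-1).

Lemma Cont_between w (i j : 'I_n) (e : K) : Cont w -> (i < j)%N ->
  ent w i = ent w j -> e = 1 \/ e = -1 ->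
  exists l : 'I_n, [/\ (i < l)%N, (l < j)%N & ent w l = (w.1 i + e, w.2 i)].
Proof.
move=> [_ h] ij [e1 e2] he; have [|l [l1 l2 l3 l4]] := h i j ij e1 e2 (w.1 i + e).
  by case: he => ->; [left | right].
by exists l; split=> //; rewrite /ent l3 l4.
Qed.

Lemma Cont_neq w k : Cont w -> ent w (lo k) <> ent w (hi k).
Proof.
move=> hw e; have [|l [l1 l2 _]] := @Cont_between w (lo k) (hi k) 1 hw _ e (or_introl erefl).
  exact: ltnSn.
by move: l1 l2 => /= l1; rewrite ltnS leqNgt l1.
Qed.

(** The single position in between would have to carry both a + 1 and a - 1. *)
Lemma Cont_neq_next w k l : 2%:R != 0 :> K -> l = k.+1 :> nat -> Cont w ->
  ent w (lo k) <> ent w (hi l).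
Proof.
move=> two0 kl hw e.
have lt : (lo k < hi l)%N by rewrite /= kl; clear; lia.
have mid (m : 'I_n) : (lo k < m)%N -> (m < hi l)%N -> m = hi k.
  by move=> /= m1 m2; apply: val_inj => /=; move: m1 m2; rewrite kl; clear; lia.
have [m1 [a1 b1 c1]] := Cont_between hw lt e (or_introl erefl).
have [m2 [a2 b2 c2]] := Cont_between hw lt e (or_intror erefl).
move: c1; rewrite (mid _ a1 b1) -(mid _ a2 b2) c2 => -[/addrI h].
case/eqP: two0; have -> : 2%:R = 1 - (-1) :> K by rewrite opprK.
by rewrite h subrr.
Qed.

(** Witnesses are transported by s_k. One could leave its interval only by being exchanged with an
    endpoint, from which it differs by 1 or -1 with the same colour; admissibility excludes this. *)
Lemma Cont_swap k w : Cont w -> admissible k w -> Cont (swapw k w).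
Proof.
move=> hw ak; split=> [i|i j ij e1 e2 a ha].
  by rewrite ffunE; case: hw => h _; apply: h.
have eij : ent w (sperm k i) = ent w (sperm k j).
  by rewrite -!ent_swap /ent e1 e2.
have [e ae he] : exists2 e, a = w.1 (sperm k i) + e & e = 1 \/ e = -1.
  move: ha; rewrite ffunE; case=> ->; [exists 1 | exists (-1)]; by auto.
have adm_e (x y : K * 'I_r) : adm x y -> y = (x.1 + e, x.2) -> False.
  by move=> axy ey; move: axy; rewrite ey /adm eqxx /=;
     case: he => ->; rewrite eqxx ?andbF.
case/orP: (sperm_lt k ij) => [lt|/andP[/eqP ei /eqP ej]]; last first.
  by move: eij; rewrite ei ej spermL spermR => /esym/(Cont_neq hw).
have [m [m1 m2 em]] := Cont_between hw lt eij he.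
exists (sperm k m).
have em' : ent (swapw k w) (sperm k m) = (a, (swapw k w).2 i).
  by rewrite ent_swap spermK em ae /= !ffunE.
split.
- have := sperm_lt k m1; rewrite spermK => /orP[//|/andP[/eqP ei /eqP ej]].
  by case: (adm_e (ent w (lo k)) (ent w (hi k)) ak); rewrite -ei -ej em.
- have := sperm_lt k m2; rewrite spermK => /orP[//|/andP[/eqP ei /eqP ej]].
  case: (adm_e (ent w (hi k)) (ent w (lo k))); first by rewrite adm_sym.
  by rewrite -ei em -ej -eij.
- by case: em'.
- by case: em'.
Qed.

Lemma wequiv_permw w w' : wequiv w w' -> exists s, w' = permw s w.
Proof.
move: w'; apply: wequiv_ind => [|k w' [s ->] _]; first by exists 1%g; rewrite permw1.
by exists (sperm k * s)%g; rewrite swap_permw.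
Qed.

End ContentVectors.

Section SeminormalProperties.
Variables (K : fieldType) (r n : nat) (zeta : K) (sq : K -> K).
Hypothesis hzeta : r.-primitive_root zeta.
Hypothesis hsq : forall a, sq a ^+ 2 = a.
Variables (D : Dmodule K r n) (lam : set (Dweight K r n)).
Variable v : Dweight K r n -> D.
Hypothesis D_basis : is_lam_basis lam v.
Hypothesis D_act : seminormal_action zeta sq lam v.
Hypothesis lam_class : Cont_class lam.

Let v_wt w (lw : lam w) : wt zeta w (v w) := seminormal_wt D_act lw.

Lemma seminormal_neq0 w : lam w -> v w != 0.
Proof.
move=> lw; have [s [_ sP /basis_free hf]] := D_basis.
by apply: free_not0 hf _; rewrite map_f //; apply/sP.
Qed.

Lemma lam_Cont w : lam w -> Cont w.
Proof. by case: lam_class => w0 _ -> []. Qed.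

Lemma lam_swap k w : lam w -> admissible k w -> lam (swapw k w).
Proof.
case: lam_class => w0 _ -> [cw ew] ak; split; first exact: Cont_swap.
exact: wequiv_step.
Qed.

Lemma seminormal_splittable : completely_splittable D.
Proof.
move=> i; have [s [_ sP hb]] := D_basis; exists [seq v w | w <- s] => //.
by move=> _ /mapP[w /sP lw ->]; exists (w.1 i); case: (v_wt lw i).
Qed.

Lemma seminormal_extract (m : D) : m != 0 ->
  exists a w c, [/\ lam w, c != 0 & dact D a m = c *: v w].
Proof.
move=> m0; have [s [s_uniq sP hb]] := D_basis.
set b := in_tuple [seq v w | w <- s].
have mE := @coord_basis _ _ fullv _ b m hb (memvf _).
have [i ci] : exists i, coord b i m != 0.
  apply: contrapT => h; case/eqP: m0; rewrite mE big1 // => i _.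
  suff -> : coord b i m = 0 by rewrite scale0r.
  by apply/eqP/negPn/negP => ci; apply: h; exists i.
have [w0 _ _] := lam_class.
have is_ (j : 'I_(size [seq v w | w <- s])) : (j < size s)%N.
  by rewrite -(size_map v); apply: ltn_ord.
have bE (j : 'I_(size [seq v w | w <- s])) : b`_j = v (nth w0 s j).
  by rewrite /= (nth_map w0 _ _ (is_ j)).
have lamj (j : 'I_(size [seq v w | w <- s])) : lam (nth w0 s j).
  by apply/sP/mem_nth/is_.
have [a [c [cw cs ca]]] := separating_element hzeta (nth w0 s i) s.
exists a, (nth w0 s i), (coord b i m); split=> //.
rewrite {1}mE linear_sum (bigD1 i) //= big1 => [|j ji].
  by rewrite addr0 linearZ /= bE (ca _ _ _ (v_wt (lamj i))) cw scale1r.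
rewrite linearZ /= bE (ca _ _ _ (v_wt (lamj j))) cs ?scale0r ?scaler0 //.
  exact/mem_nth/is_.
by rewrite nth_uniq // is_.
Qed.

(** A nonzero submodule contains some v_w by [seminormal_extract], and an admissible s_k has an
    invertible off-diagonal coefficient, so membership spreads over the whole class. *)
Lemma seminormal_irreducible : Dirreducible D.
Proof.
have [w0 cw0 lamE] := lam_class.
have lw0 : lam w0 by rewrite lamE; split=> //; exists [::].
split.
  apply: contra (seminormal_neq0 lw0) => /eqP f0.
  by rewrite -memv0 -f0 memvf.
move=> U stU; have st a m : m \in U -> dact D a m \in U.
  by move=> mU; apply: (subvP (stU a)); apply: memv_img.
have [->|U0] := eqVneq U 0%VS; [by left | right].
have step k w : lam w -> admissible k w -> v w \in U -> v (swapw k w) \in U.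
  move=> lw ak vU; have := seminormal_f D_act k lw.
  rewrite admE -(offc_neq0 hsq) in ak; move=> /eqP; rewrite addrC -subr_eq => /eqP e.
  have : offc sq (ent w (lo k)) (ent w (hi k)) *: v (swapw k w) \in U.
    by rewrite -e memvB ?st ?memvZ.
  by move/(memvZ (offc sq (ent w (lo k)) (ent w (hi k)))^-1);
     rewrite scalerA mulVf // scale1r.
have conn w : lam w -> (v w \in U) = (v w0 \in U).
  move=> lw; have : wequiv w0 w by move: lw; rewrite lamE => -[].
  suff h : forall w', wequiv w0 w' -> lam w' /\ (v w' \in U) = (v w0 \in U).
    by case/h.
  apply: wequiv_ind => // k w' [lw' <-] ak; have lk := lam_swap lw' ak.
  split=> //; apply/idP/idP => [h|]; last exact: step.
  rewrite -(swapwK k w'); apply: step => //.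
  by rewrite admE !ent_swap spermL spermR adm_sym.
have : vpick U != 0 by rewrite vpick0.
case/seminormal_extract=> a [w [c [lw c0 e]]].
have vwU : v w \in U.
  have := st a _ (memv_pick U); rewrite e => /(memvZ c^-1).
  by rewrite scalerA mulVf // scale1r.
apply/eqP; rewrite eqEsubv subvf /=.
have [s [_ sP /span_basis <-]] := D_basis; apply/span_subvP => m /mapP[w' /sP lw' ->].
by rewrite conn // -(conn _ lw).
Qed.

Lemma seminormal_weight_lam w (m : D) : wt zeta w m -> m != 0 -> lam w.
Proof.
move=> hm m0; have [s [_ sP hb]] := D_basis; apply: contrapT => nlw.
have [a [c [cw cs ca]]] := separating_element hzeta w s.
case/eqP: m0; rewrite -[m]scale1r -cw -(ca _ _ _ hm); apply/eqP.
rewrite -memv_ker; have : m \in (fullv : {vspace D}) by rewrite memvf.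
apply/subvP; rewrite -(span_basis hb); apply/span_subvP => u /mapP[w' /sP lw ->].
rewrite memv_ker (ca _ _ _ (v_wt lw)) cs ?scale0r //; first exact/sP.
by apply/eqP => e; apply: nlw; rewrite -e.
Qed.

Lemma seminormal_RepI : RepI D.
Proof.
move=> i a; rewrite /passmx.leigenvalue -vpick0; set m := vpick _ => m0.
have : m \in passmx.leigenspace (dact D (xgen K r i)) a by apply: memv_pick.
rewrite memv_ker add_lfunE opp_lfunE scale_lfunE id_lfunE subr_eq0 => /eqP xm.
apply: contrapT => nI.
have [s [_ sP hb]] := D_basis.
set b := in_tuple [seq v w | w <- s].
have [w0 _ _] := lam_class.
have bE j : (j < size s)%N -> b`_j = v (nth w0 s j).
  by move=> js; rewrite /= (nth_map w0).
case/eqP: m0; have mE := @coord_basis _ _ fullv _ b m hb (memvf _).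
rewrite mE big1 // => j _.
have js : (j < size s)%N by rewrite -(size_map v); apply: ltn_ord.
have lj : lam (nth w0 s j) by apply/sP; rewrite mem_nth.
(* This is (x_i - a) m = 0 in coordinates: a nonzero coordinate would make a an entry of a content
   vector, hence an element of I. *)
have z : \sum_(j < size [seq v w | w <- s]) (((nth w0 s j).1 i - a) * coord b j m) *: b`_j = 0.
  apply/eqP; move/eqP: xm; rewrite -subr_eq0 {1 2}mE linear_sum scaler_sumr.
  rewrite -sumrB; congr (_ == 0); apply: eq_bigr => l _.
  have ls : (l < size s)%N by rewrite -(size_map v); apply: ltn_ord.
  have ll : lam (nth w0 s l) by apply/sP; rewrite mem_nth.
  rewrite linearZ /= bE //; case: (v_wt ll i) => _ ->.
  by rewrite !scalerA -scalerBl mulrBl [X in X - _]mulrC.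
have /eqP := freeP (X := b) (basis_free hb) _ z j; rewrite mulf_eq0 => /orP[|/eqP->].
  rewrite subr_eq0 => /eqP e; case: nI; rewrite -e.
  by case: (lam_Cont lj) => h _; apply: h.
by rewrite scale0r.
Qed.

Lemma seminormal_weights w : is_weight zeta D w <-> lam w.
Proof.
have x_ss i a u :=
  @diagonalizable_square_zero _ _ _ a u (seminormal_splittable i).
split=> [[_ [m m0 /(wt_weight_space zeta x_ss)]]|lw].
  by move/seminormal_weight_lam; apply.
split; first by case: (lam_Cont lw).
by exists (v w); [exact: seminormal_neq0 | apply/(wt_weight_space zeta x_ss)/v_wt].
Qed.

End SeminormalProperties.

(** * Construction of the seminormal module *)

Section SeminormalModule.
Variables (K : fieldType) (r n : nat) (zeta : K) (sq : K -> K).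
Hypothesis hzeta : r.-primitive_root zeta.
Hypothesis r_neq0 : r%:R != 0 :> K.
Hypothesis two_neq0 : 2%:R != 0 :> K.
Hypothesis hsq : forall a, sq a ^+ 2 = a.
Variable lam : set (Dweight K r n).
Hypothesis lam_class : Cont_class lam.
Variables (w0 : Dweight K r n) (s : seq (Dweight K r n)).
Hypothesis s_uniq : uniq s.
Hypothesis sP : forall w, w \in s <-> lam w.
Implicit Types (w : Dweight K r n) (k l : 'I_n.-1).

Let V : vectType K := 'rV[K]_(size s).

(* Zero outside [lam], which lets the action formulas below hold for every [w]. *)
Let bv w : V := \row_j (nth w0 s j == w)%:R.

Let bv_out w : ~ lam w -> bv w = 0.
Proof.
move=> nw; apply/rowP => j; rewrite !mxE; case: eqP => // e; case: nw.
by rewrite -e; apply/sP/mem_nth.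
Qed.

Let bv_sum (u : V) : u = \sum_(j < size s) u 0 j *: bv (nth w0 s j).
Proof.
rewrite {1}[u](@row_sum_delta K); apply: eq_bigr => j _; congr (_ *: _).
by apply/rowP => i; rewrite !mxE eqxx nth_uniq // eq_sym.
Qed.

Let op_fun (g : Dweight K r n -> V) (u : V) : V :=
  \sum_(j < size s) u 0 j *: g (nth w0 s j).

Let op_linear g : linear (op_fun g).
Proof.
move=> a x y; rewrite /op_fun scaler_sumr -big_split /=; apply: eq_bigr => j _.
by rewrite !mxE scalerDl scalerA.
Qed.

Let op g : 'End(V) := linfun
  (HB.pack_for {linear V -> V} (op_fun g)
    (GRing.isLinear.Build K V V *:%R (op_fun g) (op_linear g))).

Let opE g w : (~ lam w -> g w = 0) -> op g (bv w) = g w.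
Proof.
move=> g0; rewrite /op lfunE /= /op_fun.
have [ws|ws] := boolP (w \in s); last first.
  have nw : ~ lam w by move/sP; apply/negP.
  by rewrite g0 // big1 // => j _; rewrite bv_out // mxE scale0r.
have iw : (index w s < size s)%N by rewrite index_mem.
rewrite (bigD1 (Ordinal iw)) //= big1 => [|j ji].
  by rewrite addr0 !mxE nth_index // eqxx scale1r.
rewrite mxE -[X in _ == X](nth_index w0 ws) nth_uniq //.
by rewrite -val_eqE /= in ji; rewrite (negbTE ji) scale0r.
Qed.

Let ext (Y Z : 'End(V)) : (forall w, lam w -> Y (bv w) = Z (bv w)) -> Y = Z.
Proof.
move=> h; apply/lfunP => u; rewrite [u]bv_sum !linear_sum; apply: eq_bigr => j _.
by rewrite !linearZ /= h //; apply/sP/mem_nth.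
Qed.

Let T i := op (fun w => zeta ^+ w.2 i *: bv w).
Let X i := op (fun w => w.1 i *: bv w).

Local Notation A w k := (diagc (ent w (lo k)) (ent w (hi k))).
Local Notation B w k := (offc sq (ent w (lo k)) (ent w (hi k))).

Let F k := op (fun w => A w k *: bv w + B w k *: bv (swapw k w)).

Let TE i w : T i (bv w) = zeta ^+ w.2 i *: bv w.
Proof. by apply: opE => nw; rewrite bv_out // scaler0. Qed.

Let XE i w : X i (bv w) = w.1 i *: bv w.
Proof. by apply: opE => nw; rewrite bv_out // scaler0. Qed.

(** For w outside [lam] the right side must vanish: if s_k w lies in [lam], then s_k is
    inadmissible, since otherwise w would lie there too. *)
Let FE k w : F k (bv w) = A w k *: bv w + B w k *: bv (swapw k w).
Proof.
apply: opE => nw; rewrite bv_out // scaler0 add0r.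
have [->|b0] := eqVneq (B w k) 0; first by rewrite scale0r.
rewrite bv_out ?scaler0 // => lw; apply: nw.
rewrite -(swapwK k w); apply: (lam_swap lam_class lw).
by rewrite admE !ent_swap spermL spermR adm_sym -(offc_neq0 hsq).
Qed.

Let opD (Y : 'End(V)) (a b : K) (p q : V) :
  Y (a *: p + b *: q) = a *: Y p + b *: Y q.
Proof. by rewrite linearD !linearZ. Qed.

Let F_far k l w : far k l -> F k (F l (bv w)) = F l (F k (bv w)).
Proof.
move=> kl; have [h1 h2 h3 h4] := far_neq kl.
have sw : swapw k (swapw l w) = swapw l (swapw k w).
  by apply: ent_inj => i; rewrite !ent_swap sperm_far // far_sym.
rewrite !(FE, opD) !ent_swap !(@spermD _ k) 1?eq_sym // !(@spermD _ l) //.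
rewrite sw; move: (diagc _ _) (offc _ _ _) (diagc _ _) (offc _ _ _) => a b c d.
rewrite !scalerDr !scalerA addrACA.
by rewrite [c * a]mulrC [b * a]mulrC [c * d]mulrC [b * d]mulrC.
Qed.

Let F_braid k l w : l = k.+1 :> nat -> lam w ->
  F k (F l (F k (bv w))) = F l (F k (F l (bv w))).
Proof.
move=> e lw; have cw := lam_Cont lam_class lw.
have el := lo_next e.
have h1 := lo_neq_hi_next e; have h2 := hi_neq_hi_next e.
have lk : sperm l (lo k) = lo k by rewrite spermD ?el ?lo_neq_hi ?h1.
have kl : sperm k (hi l) = hi l by rewrite spermD // eq_sym ?h1 ?h2.
have lh : sperm l (hi k) = hi l by rewrite -el spermL.
have hl : sperm l (hi l) = hi k by rewrite -el spermR.
have sE := (ent_swap, spermL, spermR, kl, lk, lh, hl, el).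
have xy := Cont_neq (k := k) cw.
have yz := Cont_neq (k := l) cw; rewrite el in yz.
have xz := Cont_neq_next two_neq0 e cw.
have YB := diagc_yang_baxter xy yz xz.
have lin (Y : 'End(V)) : linear Y by move=> a p q; rewrite linearP.
have quad (y z : K * 'I_r) : offc sq y z * offc sq y z = 1 - diagc y z ^+ 2.
  by rewrite -expr2 offc_sq.
(* Here the return coefficients p', q' equal p, q, and the two extreme vectors are the same basis
   vector. *)
apply/eqP; rewrite -subr_eq0.
rewrite (braid_defect (lin (F k)) (lin (F l)) YB (quad _ _) (quad _ _)
  (v := bv w) (u1 := bv (swapw k w)) (u2 := bv (swapw l w))
  (u12 := bv (swapw k (swapw l w))) (u21 := bv (swapw l (swapw k w)))
  (w1 := bv (swapw k (swapw l (swapw k w))))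
  (w2 := bv (swapw l (swapw k (swapw l w))))
  (s := offc sq (ent w (lo k)) (ent w (hi l)))) ?FE ?swapwK ?sE //.
- have -> : swapw k (swapw l (swapw k w)) = swapw l (swapw k (swapw l w)).
    by apply: ent_inj => i; rewrite !ent_swap (sperm_braid i e).
  by rewrite subrr scaler0.
- by rewrite (diagc_anti (ent w (lo k))) (offc_sym sq (ent w (lo k))).
- by rewrite (diagc_anti (ent w (hi k))) (offc_sym sq (ent w (hi k))).
Qed.

(** Each relation is checked on basis vectors. The content condition enters in the braid relation
    and in the relation between f_k and x_{k+1}, where adjacent entries must be distinct. *)
Let rel u v : drel r u v -> deval T X F u = deval T X F v.
Proof.
have cZ (Y : 'End(V)) a p : Y (a *: p) = a *: Y p by rewrite linearZ.
case=> {u v}; last first.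
- by move=> i j; apply: ext => w _; rewrite /= !comp_lfunE XE TE !cZ XE TE
     !scalerA mulrC.
- move=> k j j1 j2; apply: ext => w _; rewrite /= !comp_lfunE XE cZ FE opD !XE.
  by rewrite ffunE spermD // scalerDr !scalerA ![w.1 j * _]mulrC.
- move=> k; apply: ext => w lw.
  rewrite [RHS]add_lfunE (deval_de X F hzeta r_neq0 (TE _ _) (TE _ _)).
  rewrite /= !comp_lfunE XE cZ FE opD !XE.
  rewrite ffunE spermL scalerDr !scalerA addrAC -scalerDl.
  congr (_ *: _ + _ *: _); last exact: mulrC.
  rewrite /diagc /=; case: eqP => e; last by rewrite mulr0 mul0r addr0.
  have ne : w.1 (hi k) - w.1 (lo k) != 0.
    rewrite subr_eq0; apply/eqP => e1.
    by case: (Cont_neq (k := k) (lam_Cont lam_class lw)); rewrite /ent e e1.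
  by rewrite mulr1n; field.
- by move=> i j; apply: ext => w _; rewrite /= !comp_lfunE !XE !cZ !XE !scalerA mulrC.
- move=> k; apply: ext => w _; rewrite /= comp_lfunE FE opD !FE swapwK.
  rewrite !ent_swap spermL spermR (diagc_anti (ent w (lo k))).
  rewrite (offc_sym sq (ent w (lo k))) !scalerDr !scalerA.
  rewrite [X in _ + X]addrC addrACA -!scalerDl mulrN [B w k * A w k]mulrC subrr.
  by rewrite scale0r addr0 -!expr2 (offc_sq hsq) addrC subrK lfunE /= id_lfunE.
- move=> i; apply: ext => w _; rewrite (deval_expT _ _ _ (TE i w)) /=.
  by rewrite lfunE /= id_lfunE exprAC (prim_expr_order hzeta) expr1n.
- move=> k j; apply: ext => w _; rewrite /= !comp_lfunE TE cZ FE opD !TE ffunE spermK.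
  rewrite scalerDr !scalerA [in RHS]mulrC [B w k * _]mulrC; congr (_ *: _ + _).
  rewrite /diagc /=; case: eqP => [e|_]; last by rewrite !mulr0.
  congr (_ ^+ _ * _); congr (nat_of_ord _).
  have [->|j1] := eqVneq j (lo k); first by rewrite spermL.
  have [->|j2] := eqVneq j (hi k); first by rewrite spermR.
  by rewrite spermD.
- by move=> i j; apply: ext => w _; rewrite /= !comp_lfunE !TE !cZ !TE !scalerA mulrC.
- by move=> k l kl; apply: ext => w lw; rewrite /= !comp_lfunE F_braid.
- by move=> k l kl; apply: ext => w _; rewrite /= !comp_lfunE F_far.
Qed.

Lemma seminormal_module_exists :
  exists (D : Dmodule K r n) (v : Dweight K r n -> D),
    is_lam_basis lam v /\ seminormal_action zeta sq lam v.
Proof.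
exists (Dmodule_of_ops rel), bv; split.
  exists s; split=> //; rewrite basisEdim size_map dimvf.
  have -> : dim V = size s by exact: mul1n.
  rewrite leqnn andbT; apply/subvP => u _; rewrite [u]bv_sum.
  by apply: memv_suml => j _; rewrite memvZ // memv_span // map_f // mem_nth.
move=> w lw; split=> [i|k d].
  by rewrite Dmodule_of_opsT Dmodule_of_opsX TE XE.
rewrite Dmodule_of_opsF FE /offc /diagc /=; split=> e; last first.
  rewrite e eqxx; congr (_ *: _ + _ *: bv _).
  congr (_, _); apply/ffunP => i; rewrite ffunE /sperm.
  by case: tpermP => [->|->|//]; rewrite e.
by case: eqP => // _; rewrite scale0r add0r scale1r.
Qed.

End SeminormalModule.

(** A class is finite because its members are rearrangements of one weight. *)
Lemma Cont_class_enum (K : fieldType) (r n : nat) (lam : set (Dweight K r n)) :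
  Cont_class lam -> exists2 s, uniq s & forall w, w \in s <-> lam w.
Proof.
case=> w0 _ lamE.
exists (undup [seq w <- [seq permw t w0 | t <- enum 'S_n] | `[< lam w >]]).
  exact: undup_uniq.
move=> w; rewrite mem_undup mem_filter; split=> [/andP[/asboolP]//|lw].
apply/andP; split; first exact/asboolP.
move: lw; rewrite lamE => -[_ /wequiv_permw[t ->]].
by apply/mapP; exists t; rewrite ?mem_enum.
Qed.

(** The zero module supplies the value of D at sets that are not classes. *)
Lemma Dmodule_inhabited (K : fieldType) (r n : nat) : inhabited (Dmodule K r n).
Proof.
have lin : linear (fun _ : Drn K r n => 0 : 'End('rV[K]_0)).
  by move=> a x y; rewrite scaler0 addr0.
by constructor; apply: (@DModule K r n _ _ lin) => *; rewrite !thinmx0 ?flatmx0;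
  apply/rowP => -[].
Qed.

Theorem theorem5p10 (K : closedFieldType) (p r n : nat)
  (hp : p \in [pchar K]) (hp2 : (2 < p)%N)
  (hr : (0 < r)%N) (hpr : ~~ (p %| r)%N) (hn : (0 < n)%N)
  (zeta : K) (hzeta : r.-primitive_root zeta)
  (sq : K -> K) (hsq : forall a : K, sq a ^+ 2 = a) :
  exists D : set (Dweight K r n) -> Dmodule K r n,
    (forall lam : set (Dweight K r n), Cont_class lam ->
       [/\ RepI (D lam),
           Dirreducible (D lam),
           completely_splittable (D lam),
           (forall w : Dweight K r n, is_weight zeta (D lam) w <-> lam w) &
           exists2 v : Dweight K r n -> D lam,
             is_lam_basis lam v & seminormal_action zeta sq lam v])
    /\
    (forall M : Dmodule K r n, RepI M -> Dirreducible M ->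
       completely_splittable M ->
       exists2 lam : set (Dweight K r n), Cont_class lam & Diso M (D lam)).
Proof.
have two0 : 2%:R != 0 :> K by rewrite -(dvdn_pcharf hp) gtnNdvd.
have r0 : r%:R != 0 :> K by rewrite -(dvdn_pcharf hp).
have /choice[D hD] (lam : set (Dweight K r n)) : exists D : Dmodule K r n,
    Cont_class lam -> exists v : Dweight K r n -> D,
      is_lam_basis lam v /\ seminormal_action zeta sq lam v.
  have [lc|nlc] := pselect (Cont_class lam); last first.
    by have [D] := Dmodule_inhabited K r n; exists D.
  have [s s_uniq sP] := Cont_class_enum lc; have [w0 _ _] := lc.
  have [D hD] := seminormal_module_exists hzeta r0 two0 hsq lc w0 s_uniq sP.
  by exists D.
exists D; split=> [lam lc|M MI M_irr M_cs].
  have [v [vb va]] := hD lam lc; split.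
  - exact (seminormal_RepI vb va lc).
  - exact (seminormal_irreducible hzeta hsq vb va lc).
  - exact (seminormal_splittable vb va).
  - exact (seminormal_weights hzeta vb va lc).
  - by exists v.
have x_ss i a u := @diagonalizable_square_zero _ _ _ a u (M_cs i).
(* Any single weight of M determines its class. *)
have [w0 [v0 v00 hv0]] := exists_weight hzeta M_irr.1.
have hC w := @weight_of_Cont _ _ _ _ _ hzeta r0 two0 x_ss _ hsq w MI.
pose lam : set (Dweight K r n) := [set w' | Cont w' /\ wequiv w0 w']%classic.
have lc : Cont_class lam by exists w0; first by apply: hC; exists v0.
exists lam => //; have [v [vb va]] := hD lam lc.
have D_irr := seminormal_irreducible hzeta hsq vb va lc.
exact: (Diso_of_weight hzeta r0 two0 x_ss hsq M_irr D_irr vb va hC hv0 v00).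
Qed.
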